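(* Let $(P,[\cdot,\cdot])$ be a Leibniz manifold with associated Leibniz tensor $B$ and let $S$ be an embedded smooth submanifold of $P$. Let $D\subset TP|_S$ be a canonical subbundle of the tangent bundle of $P$ restricted to $S$ such that $D_S:=D\cap TS$ is a smooth, integrable, and regular distribution on $S$. Then $(P,[\cdot,\cdot],D,S)$ is Leibniz reducible if and only if $$B_L^{\sharp}(D^{\circ})+B_R^{\sharp}(D^{\circ})\subset TS+D .$$
   Context: **Leibniz manifolds.** A Leibniz manifold $(P,[\cdot,\cdot])$ is a smooth manifold $P$ with an $\mathbb{R}$-bilinear map $[\cdot,\cdot]$ on $C^{\infty}(P)$ that is a derivation in each entry: $[fg,h]=[f,h]g+f[g,h]$, $[f,gh]=g[f,h]+h[f,g]$ (no antisymmetry or Jacobi identity). The bracket depends only on first derivatives, so it restricts to $C^{\infty}_P(U)=C^\infty(U)$ for every open $U\subset P$, and there is a tensor $B$ with $B(\mathbf{d}f,\mathbf{d}g)=[f,g]$. The bundle maps $B_L^{\sharp},B_R^{\sharp}:T^{\ast}P\to TP$ are defined by $B(\alpha,\beta)=-\langle\beta,B_L^{\sharp}(\alpha)\rangle$ and $B(\alpha,\beta)=\langle\alpha,B_R^{\sharp}(\beta)\rangle$. $D^{\circ}\subset T^{\ast}P|_S$ is the annihilator of $D$; the displayed inclusion is understood pointwise at every $m\in S$. **Distributions.** $S$ carries the relative topology. $D$ is canonical (or Leibniz) if for any open $U\subset P$ and $f,g\in C_P^{\infty}(U)$, the conditions $\mathbf{d}f(z)|_{D(z)}=\mathbf{d}g(z)|_{D(z)}=0$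 for all $z\in U\cap S$ imply $\mathbf{d}[f,g](z)|_{D(z)}=0$ for all $z\in U\cap S$. $S/D_S$ is the space of maximal integral manifolds (leaves) of $D_S$, with projection $\pi_{D_S}:S\to S/D_S$ and the quotient topology. $D_S$ is regular when $S/D_S$ is a regular quotient manifold, i.e. it has a smooth structure for which $\pi_{D_S}$ is a surjective submersion. **The presheaf $C^{\infty}_{S/D_S}$.** For $V\subset S/D_S$ open, a function $f:V\to\mathbb{R}$ belongs to $C^{\infty}_{S/D_S}(V)$ iff for any $z\in V$ there exist $m\in\pi_{D_S}^{-1}(z)$, an open neighborhood $U_m$ of $m$ in $P$, and $F\in C^{\infty}_P(U_m)$ such that $f\circ\pi_{D_S}|_{\pi_{D_S}^{-1}(V)\cap U_m}=F|_{\pi_{D_S}^{-1}(V)\cap U_m}$; $F$ is called a local extension of $f\circ\pi_{D_S}$ at $m$. It is a local $D$-invariant extension at $m$ if moreover $\mathbf{d}F(n)|_{D(n)}=0$ for any $n\in\pi_{D_S}^{-1}(V)\cap U_m$. $C^{\infty}_{S/D_S}$ has the $(D,D_S)$-local extension property when for every open $V\subset S/D_S$, every $f\in C^{\infty}_{S/D_S}(V)$ and every $m\in\pi_{D_S}^{-1}(V)$ there is a local $D$-invariant extension of $f\circ\pi_{D_S}$ at $m$. **Leibniz reducibility.** A presheaf of Leibniz algebras on a topological space with a presheaf $\mathcal{F}$ of functions assigns to each open $V$ a bilinear operation $\mathcal{F}(V)\times\mathcal{F}(V)\to\mathcal{F}(V)$ that is a derivation in each entry. $(P,[\cdot,\cdot],D,S)$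 is Leibniz reducible when $C^{\infty}_{S/D_S}$ has the $(D,D_S)$-local extension property and $(S/D_S,C^{\infty}_{S/D_S},[\cdot,\cdot]^{S/D_S})$ is a well defined presheaf of Leibniz algebras, where for any open $V\subset S/D_S$ the bracket $[\cdot,\cdot]_V^{S/D_S}:C^{\infty}_{S/D_S}(V)\times C^{\infty}_{S/D_S}(V)\to C^{\infty}_{S/D_S}(V)$ is given by $$[f,g]_V^{S/D_S}(\pi_{D_S}(m)):=[F,G](m)$$ for any $m\in\pi_{D_S}^{-1}(V)$ and any local $D$-invariant extensions $F,G$ at $m$ of $f\circ\pi_{D_S}$ and $g\circ\pi_{D_S}$, respectively (well defined meaning in particular that the right-hand side is independent of the choices). *)

(* Defs.v *)
From HB Require Import structures.
From mathcomp Require Import all_boot all_order all_algebra generic_quotient.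
From mathcomp Require Import all_classical all_reals topology normedtype derive.
Import GRing.Theory Num.Theory numFieldNormedType.Exports.

Set Implicit Arguments.
Unset Strict Implicit.
Unset Printing Implicit Defensive.

Local Open Scope classical_set_scope.
Local Open Scope ring_scope.
Local Open Scope quotient_scope.

(** * Smooth manifolds *)

(* [Ck k U f], for U open: all partial derivatives of f of order at most k
   exist and are continuous on U. *)
Fixpoint Ck (R : realType) (n : nat) (V : normedModType R) (k : nat)
    (U : set 'rV[R]_n) (f : 'rV[R]_n -> V) : Prop :=
  if k is k'.+1 then
    forall j : 'I_n,
      (forall u, U u -> derivable f u (delta_mx 0 j)) /\
      Ck k' U (fun u => 'D_(delta_mx 0 j) f u)
  else forall u, U u -> {for u, continuous f}.

Definition Csmooth (R : realType) (n : nat) (V : normedModType R)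
    (U : set 'rV[R]_n) (f : 'rV[R]_n -> V) : Prop :=
  forall k, Ck k U f.

(* The values of [cmap] outside [cdom], and of [cinv] outside the image of
   [cdom], are irrelevant. *)
Record chart (R : realType) (M : topologicalType) := Chart {
  cdim : nat;
  cdom : set M;
  cmap : M -> 'rV[R]_cdim;
  cinv : 'rV[R]_cdim -> M;
  cdom_open : open cdom;
  cimg_open : open (cmap @` cdom);
  cmapK : forall x, cdom x -> cinv (cmap x) = x;
  cmap_cont : forall x, cdom x -> {for x, continuous cmap};
  cinv_cont : forall u, (cmap @` cdom) u -> {for u, continuous cinv} }.
Arguments cmap {R M} c _.
Arguments cinv {R M} c _.

(* The atlas is the family of the [chart_at x]; every smooth structure has such
   an atlas.  The dimension may vary between connected components.  Points of
   T_x M are written in the chart at x, see [tangent] below. *)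
Record smooth_structure (R : realType) (M : topologicalType) := SmoothStructure {
  chart_at : M -> chart R M;
  mem_chart_at : forall x, cdom (chart_at x) x;
  chart_compat : forall x y,
    Csmooth (cmap (chart_at x) @` (cdom (chart_at x) `&` cdom (chart_at y)))
            (cmap (chart_at y) \o cinv (chart_at x));
  manifold_hausdorff : hausdorff_space M;
  manifold_second_countable : @second_countable M }.

Record manifold (R : realType) := Manifold {
  msort :> topologicalType;
  mstruct : smooth_structure R msort }.

Definition mchart (R : realType) (M : manifold R) (x : M) : chart R M :=
  chart_at (mstruct M) x.

Notation mdim x := (cdim (mchart x)).
Notation tangent R x := 'rV[R]_(mdim x).
Notation cotangent R x := 'cV[R]_(mdim x).

(* f restricted to the open set U is smooth; f is arbitrary elsewhere. *)
Definition smooth_on (R : realType) (M : manifold R) (V : normedModType R)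
    (U : set M) (f : M -> V) : Prop :=
  forall x : M,
    Csmooth (cmap (mchart x) @` (cdom (mchart x) `&` U))
            (f \o cinv (mchart x)).

Definition smooth_map (R : realType) (M N : manifold R) (f : M -> N) : Prop :=
  continuous f /\
  forall y : N, smooth_on (f @^-1` cdom (mchart y)) (cmap (mchart y) \o f).

Definition tangent_map (R : realType) (M N : manifold R) (f : M -> N) (x : M) :
    'Hom(tangent R x, tangent R (f x)) :=
  linfun ('d (cmap (mchart (f x)) \o f \o cinv (mchart x))
             (cmap (mchart x) x)).

(* Coordinates, in the chart at y, of a tangent vector at a point x of the
   domain of that chart. *)
Definition tangent_coord (R : realType) (M : manifold R) (y x : M)
    (v : tangent R x) : tangent R y :=
  'd (cmap (mchart y) \o cinv (mchart x)) (cmap (mchart x) x) v.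

Definition pairing (R : realType) (n : nat) (a : 'cV[R]_n) (v : 'rV[R]_n) : R :=
  (v *m a) 0 0.

Definition dfun (R : realType) (M : manifold R) (F : M -> R) (x : M) :
    cotangent R x :=
  \col_j 'D_(delta_mx 0 j) (F \o cinv (mchart x)) (cmap (mchart x) x).

Definition immersion (R : realType) (M N : manifold R) (f : M -> N) : Prop :=
  smooth_map f /\ forall x, lker (tangent_map f x) = 0%VS.

Definition submersion (R : realType) (M N : manifold R) (f : M -> N) : Prop :=
  smooth_map f /\ forall x, limg (tangent_map f x) = fullv.

(* An embedded submanifold of P is given by its inclusion i : S -> P; the last
   clause says that S carries the relative topology. *)
Definition embedding (R : realType) (S P : manifold R) (i : S -> P) : Prop :=
  [/\ immersion i, injective i &
      forall W : set S, open W ->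
        exists2 U : set P, open U & W = i @^-1` U].

(** * Distributions *)

(* Families of subspaces of T_(i s) P: with i = id, generalized distributions
   on S; with i an embedding, subsets of TP|_S that are linear on fibres. *)
Notation distr_along R i := (forall s, {vspace tangent R (i s)}).

Definition smooth_field_along (R : realType) (S P : manifold R) (i : S -> P)
    (W : set S) (X : forall s, tangent R (i s)) : Prop :=
  forall y : P,
    smooth_on (W `&` i @^-1` cdom (mchart y))
              (fun s => tangent_coord y (X s)).

Definition subbundle_along (R : realType) (S P : manifold R) (i : S -> P)
    (D : distr_along R i) : Prop :=
  forall s0 : S, exists (W : set S) (d : nat)
      (X : 'I_d -> forall s, tangent R (i s)),
    [/\ open W, W s0, forall k, smooth_field_along W (X k) &
        forall s, W s -> basis_of (D s) [seq X k s | k <- enum 'I_d]].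

Section Distribution.
Context {R : realType} {S : manifold R}.
Implicit Type E : forall s : S, {vspace tangent R s}.

Definition smooth_distribution E : Prop :=
  forall (s0 : S) (v : tangent R s0), v \in E s0 ->
  exists (W : set S) (X : forall s, tangent R s),
    [/\ open W, W s0, @smooth_field_along R S S id W X,
        forall s, W s -> X s \in E s & X s0 = v].

(* A connected injectively immersed submanifold everywhere tangent to, and of
   the rank of, the distribution; [L] is its underlying set. *)
Definition integral_manifold E (L : set S) : Prop :=
  exists (N : manifold R) (j : N -> S),
    [/\ connected [set: N], immersion j, injective j, range j = L &
        forall x, limg (tangent_map j x) = E (j x)].

(* Maximality in Sussmann's sense. *)
Definition maximal_integral_manifold E (L : set S) : Prop :=
  integral_manifold E L /\
  forall L', integral_manifold E L' -> L' `&` L !=set0 -> L' `<=` L.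

Definition integrable E : Prop :=
  forall s : S, exists2 L, integral_manifold E L & L s.

(* The maximal integral manifold through s, unique if there is one. *)
Definition leaf E (s : S) : set S :=
  [set s' | exists L, [/\ maximal_integral_manifold E L, L s & L s']].

Definition same_leaf E : rel S := fun s s' => `[< leaf E s = leaf E s' >].

Lemma same_leaf_equiv E : equiv_class_of (same_leaf E).
Proof.
split; first by move=> s; apply/asboolP.
- by move=> s s'; apply/asboolP/asboolP => ->.
- move=> s s' s'' /asboolP h1 /asboolP h2; apply/asboolP.
  exact: etrans h1 h2.
Qed.

Canonical same_leaf_rel E := EquivRelPack (same_leaf_equiv E).

(* S / E with the quotient topology *)
Definition leaf_space E : topologicalType :=
  quotient_topology {eq_quot same_leaf_rel E}.

Definition leaf_proj E (s : S) : leaf_space E :=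
  (\pi_({eq_quot same_leaf_rel E}) s)%qT.

(* The first clause is what makes the projection onto the space of maximal
   integral manifolds defined on all of S; by the Stefan-Sussmann theorem it
   holds for every smooth integrable E. *)
Definition regular_distribution E : Prop :=
  (forall s : S, exists2 L, maximal_integral_manifold E L & L s) /\
  exists A : smooth_structure R (leaf_space E),
    set_surj [set: S] [set: leaf_space E] (leaf_proj E) /\
    @submersion R S (Manifold A) (leaf_proj E).

End Distribution.

(** * Leibniz manifolds *)

Section Leibniz.
Context {R : realType} {P : manifold R}.

(* Only the values of [br] on pairs of smooth functions matter. *)
Definition leibniz_bracket (br : (P -> R) -> (P -> R) -> (P -> R)) : Prop :=
  let Cinf := smooth_on [set: P] in
  (forall f g, Cinf f -> Cinf g -> Cinf (br f g)) /\
  (forall (a : R) f g h, Cinf f -> Cinf g -> Cinf h ->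
    [/\ br (a *: f + g) h = a *: br f h + br g h,
        br h (a *: f + g) = a *: br h f + br h g,
        br (f * g) h = br f h * g + f * br g h &
        br f (g * h) = g * br f h + h * br f g]).

Implicit Type B : forall x : P, 'M[R]_(mdim x).

Definition tensor_eval B (x : P) (a b : cotangent R x) : R :=
  (a^T *m B x *m b) 0 0.

(* The bracket that [B] induces on C^oo(U), for every open U. *)
Definition tensor_bracket B (f g : P -> R) : P -> R :=
  fun x => tensor_eval B (dfun f x) (dfun g x).

Definition leibniz_tensor (br : (P -> R) -> (P -> R) -> (P -> R)) B : Prop :=
  (forall U f g, open U -> smooth_on U f -> smooth_on U g ->
     smooth_on U (tensor_bracket B f g)) /\
  (forall f g, smooth_on [set: P] f -> smooth_on [set: P] g ->
     br f g = tensor_bracket B f g).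

Definition sharpL B (x : P) (a : cotangent R x) : tangent R x :=
  - (a^T *m B x).

Definition sharpR B (x : P) (b : cotangent R x) : tangent R x :=
  (B x *m b)^T.

Lemma sharpLE B x (a b : cotangent R x) :
  tensor_eval B a b = - pairing b (sharpL B a).
Proof. by rewrite /tensor_eval /pairing /sharpL mulNmx [in RHS]mxE opprK. Qed.

Lemma sharpRE B x (a b : cotangent R x) :
  tensor_eval B a b = pairing a (sharpR B b).
Proof.
rewrite /tensor_eval /pairing /sharpR -mulmxA.
by rewrite -[a in RHS]trmxK -trmx_mul [RHS]mxE.
Qed.

End Leibniz.

(** * Reduction *)

Section Reduction.
Context {R : realType} {P S : manifold R}.
Variables (i : S -> P) (D : forall s : S, {vspace tangent R (i s)}).

(* T_s S as a subspace of T_(i s) P *)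
Definition TS (s : S) : {vspace tangent R (i s)} := limg (tangent_map i s).

(* D_S = D \cap TS, as a family of subspaces of the T_s S *)
Definition DS (s : S) : {vspace tangent R s} := (tangent_map i s @^-1: D s)%VS.

Definition annihilates (s : S) (a : cotangent R (i s)) : Prop :=
  forall v, v \in D s -> pairing a v = 0.

Variable B : forall x : P, 'M[R]_(mdim x).

Definition canonical_along : Prop :=
  forall (U : set P) (f g : P -> R), open U -> smooth_on U f -> smooth_on U g ->
  (forall s, U (i s) ->
     annihilates (dfun f (i s)) /\ annihilates (dfun g (i s))) ->
  forall s, U (i s) -> annihilates (dfun (tensor_bracket B f g) (i s)).

Local Notation Q := (leaf_space DS).
Local Notation pi := (leaf_proj DS).

Definition local_extension (V : set Q) (f : Q -> R) (m : S)
    (U : set P) (F : P -> R) : Prop :=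
  [/\ open U, U (i m), smooth_on U F &
      forall s, V (pi s) -> U (i s) -> f (pi s) = F (i s)].

Definition invariant_extension (V : set Q) (f : Q -> R) (m : S)
    (U : set P) (F : P -> R) : Prop :=
  local_extension V f m U F /\
  forall s, V (pi s) -> U (i s) -> annihilates (dfun F (i s)).

(* The restriction of f to the open set V is a section of the presheaf. *)
Definition Cinf_leaf (V : set Q) (f : Q -> R) : Prop :=
  forall z, V z ->
  exists m U F, pi m = z /\ local_extension V f m U F.

Definition local_extension_property : Prop :=
  forall (V : set Q) (f : Q -> R), open V -> Cinf_leaf V f ->
  forall m, V (pi m) -> exists U F, invariant_extension V f m U F.

(* Functions on V are represented by functions on the whole leaf space, and
   equality of functions on V is pointwise equality on V. *)
Definition presheaf_of_leibniz_algebras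
    (brQ : set Q -> (Q -> R) -> (Q -> R) -> (Q -> R)) : Prop :=
  forall V : set Q, open V ->
  (forall f g, Cinf_leaf V f -> Cinf_leaf V g -> Cinf_leaf V (brQ V f g)) /\
  (forall (a : R) f g h, Cinf_leaf V f -> Cinf_leaf V g -> Cinf_leaf V h ->
    [/\ {in V, brQ V (a *: f + g) h =1 a *: brQ V f h + brQ V g h},
        {in V, brQ V h (a *: f + g) =1 a *: brQ V h f + brQ V h g},
        {in V, brQ V (f * g) h =1 brQ V f h * g + f * brQ V g h} &
        {in V, brQ V f (g * h) =1 g * brQ V f h + h * brQ V f g}]).

(* Under the local extension property, the second clause determines [brQ V] on
   functions on V; its existence is the well-definedness of the bracket. *)
Definition leibniz_reducible : Prop :=
  local_extension_property /\
  exists brQ : set Q -> (Q -> R) -> (Q -> R) -> (Q -> R),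
    presheaf_of_leibniz_algebras brQ /\
    forall (V : set Q) (f g : Q -> R), open V ->
      Cinf_leaf V f -> Cinf_leaf V g ->
    forall m U F U' G, V (pi m) ->
      invariant_extension V f m U F -> invariant_extension V g m U' G ->
      brQ V f g (pi m) = tensor_bracket B F G (i m).

End Reduction.

(* Main.v *)
From HB Require Import structures.
From mathcomp Require Import all_boot all_order all_algebra generic_quotient.
From mathcomp Require Import all_classical all_reals interval_inference.
From mathcomp Require Import topology normedtype landau derive sequences.
From mathcomp Require Import measure lebesgue_measure.
From mathcomp Require Import ring lra zify.
Require Import Defs.
Import Order.TTheory GRing.Theory Num.Theory numFieldNormedType.Exports.
Set Implicit Arguments.
Unset Strict Implicit.
Unset Printing Implicit Defensive.
Local Open Scope classical_set_scope.
Local Open Scope ring_scope.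

(** The theorem rests on one construction of extensions and on one fact about
    the leaves.

    Extensions. Work in charts around m and i m, let M(u) be the matrix whose
    rows are the partial derivatives of the inclusion and a frame of D. Its
    left kernel is D_S, so its rank is upper semicontinuous because D_S is
    spanned by smooth fields, and it is lower semicontinuous like every rank:
    it is locally constant, and linear systems with matrix M(u) are solved
    smoothly in u ([smooth_linear_solution]). If h is smooth on S with dh zero
    on D_S, this yields a smooth field w of covectors of P along S that extends
    dh and kills D, and, with a smooth retraction r onto S,
        F(x) = h(r x) + < w(r x), x - i(r x) >
    restricts to h on S and has dF = w there ([adapted_extension]); the value
    of w at one point can be prescribed. The retraction, and the smoothness on
    the leaf space of the functions that lift smoothly to S, come from an
    inverse function theorem ([local_inverse]). Since D_S is contained in the
    kernel of T pi, the local extension property always holds.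

    Leaves. Conversely ker T pi is contained in D_S ([kernel_sub_DS]). If v in
    ker T pi is not in D_S, some curve with velocity v stays in one fibre of pi
    and is transverse to D_S. That fibre is a leaf, the image of a
    second-countable N, and transversality isolates in N the points that lie
    over the curve, so that an interval would be countable.

    The inclusion implies reducibility: two invariant extensions of f at m have
    differentials that differ by a covector killing TS + D, and such covectors
    pair to zero with the vectors sharpL(dF), sharpR(dG), so [F,G](m) depends on
    f, g and m only ([bracket_indep]). Canonicity says that d[F,G] kills D,
    hence s |-> [F,G](s) is locally constant on a leaf, and leaves are connected
    ([bracket_leaf]).

    Reducibility implies the inclusion: let a kill D and c kill TS + D. As
    ker T pi = D_S, the covector a restricted to TS comes from a covector of the
    leaf space, so some invariant extension F of a function has dF = a at m; the
    zero function has an invariant extension G with dG = c, and another one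
    equal to 0. Well-definedness gives B(a, c) = [F, G](m) = [F, 0](m) = 0, and
    B(c, a) = 0 likewise ([reducible_orthogonal]); that is the inclusion, by
    duality. *)

(** * Neighbourhoods *)
Lemma open_near (T : topologicalType) (U : set T) (x : T) :
  open U -> U x -> \forall y \near x, U y.
Proof. by move=> oU Ux; exact: open_nbhs_nbhs. Qed.

Lemma near_forall (T : topologicalType) (I : finType) (x : T) (P : I -> T -> Prop) :
  (forall i, \forall y \near x, P i y) -> \forall y \near x, forall i, P i y.
Proof. by move=> h; apply: filter_forall. Qed.

Lemma near_continuous (T W : topologicalType) (f : T -> W) (x : T) (U : set W) :
  {for x, continuous f} -> nbhs (f x) U -> \forall y \near x, U (f y).
Proof. by move=> fx /fx. Qed.

Lemma continuous_near_eq (T W : topologicalType) (f g : T -> W) (x : T) :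
  (\forall y \near x, f y = g y) ->
  {for x, continuous f} -> {for x, continuous g}.
Proof.
move=> fg; rewrite /prop_for /continuous_at -(nbhs_singleton fg) => fx.
apply: cvg_trans fx; apply: near_eq_cvg; exact: fg.
Qed.

(** * Smooth functions of several variables *)
Section PointwiseCk.
Context {R : realType} {n : nat} {V : normedModType R}.
Implicit Types (f g : 'rV[R]_n -> V) (U : set 'rV[R]_n) (u : 'rV[R]_n).

(** The condition [Ck k U f] is a conjunction over the points of U, and at each
    point it depends on the germ of f only. Smoothness can therefore be handled
    point by point. *)
Lemma Ck_set1P k U f : Ck k U f <-> forall u, U u -> Ck k [set u] f.
Proof.
elim: k f => [|k IH] f /=; first by split=> [h u Uu v ->|h u Uu]; [exact: h|exact: (h u Uu u)].
split=> [h u Uu j|h j].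
  have [h1 h2] := h j; split; first by move=> v ->; exact: h1.
  by move/IH : h2; apply.
split=> [u Uu|]; first by have [h1 _] := h u Uu j; exact: h1.
by apply/IH => u Uu; have [_] := h u Uu j.
Qed.

Lemma near_derive_eq f g (u v : 'rV[R]_n) : (\forall x \near u, f x = g x) ->
  \forall x \near u, 'D_v f x = 'D_v g x.
Proof. by move/near_join; apply: filterS => x; exact: near_eq_derive. Qed.

Lemma Ck_near_eq k f g u :
  (\forall x \near u, f x = g x) -> Ck k [set u] f -> Ck k [set u] g.
Proof.
elim: k f g => [|k IH] f g fg /=.
  by move=> h v ->; exact: continuous_near_eq (h u erefl).
move=> h j; have [h1 h2] := h j; split.
  by move=> v ->; apply: near_eq_derivable (h1 u erefl).
by apply: IH h2; exact: near_derive_eq.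
Qed.

Lemma Csmooth_set1P U f : Csmooth U f <-> forall u, U u -> Csmooth [set u] f.
Proof.
split=> [h u Uu k|h k]; first by have /Ck_set1P := h k; apply.
by apply/Ck_set1P => u /h; apply.
Qed.

Lemma Csmooth_near_eq f g u :
  (\forall x \near u, f x = g x) -> Csmooth [set u] f -> Csmooth [set u] g.
Proof. by move=> fg h k; apply: Ck_near_eq fg (h k). Qed.

Lemma Ck_eq_open k U f g : open U -> (forall x, U x -> f x = g x) ->
  Ck k U f -> Ck k U g.
Proof.
move=> oU fg /Ck_set1P h; apply/Ck_set1P => u Uu; apply: Ck_near_eq (h u Uu).
by apply: filterS (open_nbhs_nbhs (conj oU Uu)).
Qed.

(** Smoothness near a point, with one neighbourhood valid for all orders of
    differentiation. *)
Definition smooth_near f u := \forall v \near u, Csmooth [set v] f.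

Lemma smooth_near_eq f g u :
  (\forall x \near u, f x = g x) -> smooth_near f u -> smooth_near g u.
Proof.
move=> /near_join fg; apply: filterS2 fg => v; exact: Csmooth_near_eq.
Qed.

Lemma smooth_near_near f u : smooth_near f u -> \forall v \near u, smooth_near f v.
Proof. by move/near_join. Qed.

Lemma smooth_nearP U f : open U ->
  Csmooth U f <-> forall u, U u -> smooth_near f u.
Proof.
move=> oU; split=> [h u Uu|h].
  by apply: filterS (open_nbhs_nbhs (conj oU Uu)) => v; move: v; apply/Csmooth_set1P.
by apply/Csmooth_set1P => u /h; exact: nbhs_singleton.
Qed.

Lemma smooth_near_open f u :
  smooth_near f u -> exists U, [/\ open U, U u & Csmooth U f].
Proof.
move=> h; exists [set v | smooth_near f v]°.
split; [exact: open_interior|exact: (smooth_near_near h)|].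
by apply/Csmooth_set1P => v /nbhs_singleton/nbhs_singleton.
Qed.

Lemma open_smooth_near U f u : open U -> U u -> Csmooth U f -> smooth_near f u.
Proof. by move=> oU Uu /smooth_nearP; apply. Qed.

Lemma Csmooth_derivable U f j u :
  Csmooth U f -> U u -> derivable f u (delta_mx 0 j).
Proof. by move=> /(_ 1%N)/(_ j)[+ _]; apply. Qed.

Lemma Csmooth_derive U f j : Csmooth U f -> Csmooth U ('D_(delta_mx 0 j) f).
Proof. by move=> h k; have [] := h k.+1 j. Qed.

Lemma smooth_near_continuous f u : smooth_near f u -> {for u, continuous f}.
Proof. by move/nbhs_singleton/(_ 0%N); apply. Qed.

Lemma smooth_near_derivable f j u :
  smooth_near f u -> derivable f u (delta_mx 0 j).
Proof. by move/nbhs_singleton/Csmooth_derivable; apply. Qed.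

Lemma smooth_near_derive f j u :
  smooth_near f u -> smooth_near ('D_(delta_mx 0 j) f) u.
Proof. by apply: filterS => v; exact: Csmooth_derive. Qed.

Lemma Ck_add k U f g : open U -> Ck k U f -> Ck k U g -> Ck k U (f + g).
Proof.
move=> oU; elim: k f g => [|k IH] f g /= hf hg.
  by move=> u Uu; apply: continuousD; [exact: hf|exact: hg].
move=> j; have [f1 f2] := hf j; have [g1 g2] := hg j; split.
  by move=> u Uu; apply: derivableD; [exact: f1|exact: g1].
apply: Ck_eq_open (IH _ _ f2 g2) => // u Uu /=.
by rewrite deriveD//; [exact: f1|exact: g1].
Qed.

Lemma Ck_cst k U (c : V) : open U -> Ck k U (cst c).
Proof.
elim: k c => [|k IH] c oU /=; first by move=> u _; exact: cst_continuous.
move=> j; split; first by move=> u _; exact: derivable_cst.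
apply: Ck_eq_open (IH 0 oU) => // u _ /=.
by rewrite derive_cst.
Qed.

Lemma smooth_near_cst (c : V) u : smooth_near (cst c) u.
Proof.
by apply: (@open_smooth_near setT); [exact: openT| |move=> k; apply: Ck_cst; exact: openT].
Qed.

Lemma smooth_near_common_open f g u : smooth_near f u -> smooth_near g u ->
  exists U, [/\ open U, U u, Csmooth U f & Csmooth U g].
Proof.
move=> /smooth_near_open[U [oU Uu hU]] /smooth_near_open[W [oW Wu hW]].
exists (U `&` W); split => //; first exact: openI.
- by apply/Csmooth_set1P => v [Uv _]; move/Csmooth_set1P: hU; apply.
- by apply/Csmooth_set1P => v [_ Uv]; move/Csmooth_set1P: hW; apply.
Qed.

Lemma smooth_nearD f g u :
  smooth_near f u -> smooth_near g u -> smooth_near (f + g) u.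
Proof.
move=> hf hg; have [U [oU Uu fU gU]] := smooth_near_common_open hf hg.
by apply: (open_smooth_near oU Uu) => k; apply: Ck_add.
Qed.

Lemma smooth_near_sum (I : Type) (r : seq I) (F : I -> 'rV[R]_n -> V) u :
  (forall i, smooth_near (F i) u) -> smooth_near (fun v => \sum_(i <- r) F i v) u.
Proof.
move=> h; elim: r => [|i r IH].
  under eq_fun do rewrite big_nil.
  exact: smooth_near_cst.
under eq_fun do rewrite big_cons.
exact: (smooth_nearD (h i) IH).
Qed.

End PointwiseCk.

Section ScalarAlgebra.
Context {R : realType} {n : nat}.
Implicit Types (f g : 'rV[R]_n -> R) (U : set 'rV[R]_n) (u : 'rV[R]_n).

(** The hypotheses range over all orders up to k, since [Ck k.+1] constrains the
    derivatives of f and says nothing directly about f itself. *)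
Lemma Ck_mul k U f g : open U -> (forall l, (l <= k)%N -> Ck l U f) ->
  (forall l, (l <= k)%N -> Ck l U g) -> Ck k U (f * g).
Proof.
move=> oU; elim: k f g => [|k IH] f g hf hg.
  by move=> u Uu; apply: continuousM; [exact: (hf 0%N)|exact: (hg 0%N)].
move=> j; split.
  move=> u Uu; apply: derivableM.
    by have [+ _] := hf k.+1 (leqnn _) j; exact.
  by have [+ _] := hg k.+1 (leqnn _) j; exact.
have Df l : (l <= k)%N -> Ck l U ('D_(delta_mx 0 j) f).
  by move=> lk; have [] := hf l.+1 lk j.
have Dg l : (l <= k)%N -> Ck l U ('D_(delta_mx 0 j) g).
  by move=> lk; have [] := hg l.+1 lk j.
have := Ck_add oU (IH _ _ (fun l lk => hf l (leqW lk)) Dg)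
                  (IH _ _ (fun l lk => hg l (leqW lk)) Df).
apply: Ck_eq_open => // u Uu /=.
rewrite deriveM//.
  by have [+ _] := hf k.+1 (leqnn _) j; exact.
by have [+ _] := hg k.+1 (leqnn _) j; exact.
Qed.

Lemma Csmooth_mul U f g :
  open U -> Csmooth U f -> Csmooth U g -> Csmooth U (f * g).
Proof. by move=> oU hf hg k; apply: Ck_mul. Qed.

Lemma smooth_nearM f g u :
  smooth_near f u -> smooth_near g u -> smooth_near (f * g) u.
Proof.
move=> hf hg; have [U [oU Uu fU gU]] := smooth_near_common_open hf hg.
by apply: (open_smooth_near oU Uu); exact: Csmooth_mul.
Qed.

Lemma smooth_near_prod (I : Type) (r : seq I) (F : I -> 'rV[R]_n -> R) u :
  (forall i, smooth_near (F i) u) -> smooth_near (fun v => \prod_(i <- r) F i v) u.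
Proof.
move=> h; elim: r => [|i r IH].
  under eq_fun do rewrite big_nil.
  exact: smooth_near_cst.
under eq_fun do rewrite big_cons.
exact: (smooth_nearM (h i) IH).
Qed.

Lemma smooth_nearN f u : smooth_near f u -> smooth_near (- f) u.
Proof.
move=> hf; have := smooth_nearM (smooth_near_cst (-1 : R) u) hf.
suff -> : cst (-1) * f = - f by [].
by apply/funext => v; exact: mulN1r.
Qed.

Lemma smooth_nearV f u : smooth_near f u -> f u != 0 ->
  smooth_near (fun v => (f v)^-1) u.
Proof.
move=> hf fu0; have [U [oU Uu fU]] := smooth_near_open hf.
pose W := U `&` [set v | f v != 0]°.
have fW : Csmooth W f.
  by apply/Csmooth_set1P => v [Uv _]; move/Csmooth_set1P: fU; apply.
have nzW v : W v -> f v != 0 by case=> _ /nbhs_singleton.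
have oW : open W by apply: openI => //; exact: open_interior.
apply: (@open_smooth_near _ _ _ W) => //.
  split; first exact: Uu.
  apply: (near_continuous (smooth_near_continuous hf) (U := [set t | t != 0])).
  exact: (open_nbhs_nbhs (conj (@open_neq _ (0 : R)) fu0)).
move=> k; elim/ltn_ind: k => -[|k] IH.
  move=> v Wv; apply: continuousV; [exact: nzW|exact: (fW 0%N)].
move=> j; split.
  move=> v Wv; apply: derivableV; [exact: nzW|exact: Csmooth_derivable Wv].
have IHV l : (l <= k)%N -> Ck l W (fun v => (f v)^-1) by move=> lk; apply: IH.
have D l : (l <= k)%N -> Ck l W (- 'D_(delta_mx 0 j) f).
  move=> _; apply: (Ck_eq_open oW (f := cst (-1) * 'D_(delta_mx 0 j) f)).
    by move=> v _; exact: mulN1r.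
  apply: Csmooth_mul => //; first by move=> ?; exact: Ck_cst.
  exact: Csmooth_derive.
have VV l : (l <= k)%N -> Ck l W ((fun v => (f v)^-1) * (fun v => (f v)^-1)).
  by move=> lk; apply: Ck_mul => // i il; apply: IHV; exact: leq_trans lk.
apply: (Ck_eq_open oW _ (Ck_mul oW VV D)) => v Wv /=.
rewrite deriveV; [|exact: nzW|exact: Csmooth_derivable Wv].
by rewrite scaleNr -exprVn expr2; exact: mulrN.
Qed.
End ScalarAlgebra.

Section VectorComponents.
Context {R : realType} {n p q : nat}.
Implicit Types (f : 'rV[R]_n -> 'M[R]_(p, q)) (U : set 'rV[R]_n) (u : 'rV[R]_n).

Lemma continuous_mxP (T : topologicalType) (f : T -> 'M[R]_(p, q)) x :
  {for x, continuous f} <-> forall i j, {for x, continuous (fun y => f y i j)}.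
Proof.
split=> [h i j|h].
  exact: (continuous_comp (g := fun M : 'M[R]_(p, q) => M i j) h
    (@coord_continuous R p q i j (f x))).
apply/cvgrPdist_le => e e0.
near=> y.
rewrite [leLHS]/Num.Def.normr/= mx_normrE (bigmax_le _ (ltW e0))//= => k _.
rewrite !mxE/=.
move: k; near: y; apply: filter_forall => /= k.
by have /cvgrPdist_le := h k.1 k.2; apply.
Unshelve. all: by end_near. Qed.

Lemma Ck_mxP k U f : open U ->
  Ck k U f <-> forall i j, Ck k U (fun u => f u i j).
Proof.
move=> oU; elim: k f => [|k IH] f /=.
  split=> [h i j u Uu|h u Uu]; first by move/continuous_mxP: (h u Uu); apply.
  by apply/continuous_mxP => i j; exact: h.
split=> [h i j l|h l].
  have [h1 h2] := h l; split=> [u Uu|]; first by move/derivable_mxP: (h1 u Uu); apply.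
  move/IH : h2 => /(_ i j); apply: Ck_eq_open => // u Uu.
  by rewrite derive_mx ?mxE//; exact: h1.
have hd u : U u -> derivable f u (delta_mx 0 l).
  by move=> Uu; apply/derivable_mxP => i j; have [+ _] := h i j l; apply.
split=> //; apply/IH => i j; have [_] := h i j l.
apply: Ck_eq_open => // u Uu.
by rewrite derive_mx ?mxE//; exact: hd.
Qed.

Lemma smooth_near_mxP f u :
  smooth_near f u <-> forall i j, smooth_near (fun v => f v i j) u.
Proof.
split=> [/smooth_near_open[U [oU Uu fU]] i j|h].
  by apply: (open_smooth_near oU Uu) => k; have /Ck_mxP := fU k; apply.
pose W := [set v | forall i j, smooth_near (fun v => f v i j) v]°.
have Wu : W u.
  apply: (near_forall (P := fun i v => forall j, smooth_near (fun v => f v i j) v)).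
  move=> i; apply: (near_forall (P := fun j v => smooth_near (fun v => f v i j) v)).
  by move=> j; exact: smooth_near_near.
have oW : open W by exact: open_interior.
apply: (open_smooth_near oW Wu) => k; apply/Ck_mxP => // i j.
move: k; apply/(smooth_nearP _ oW) => v /nbhs_singleton; exact.
Qed.

End VectorComponents.

Lemma le_norm_coord {R : realType} n (u : 'rV[R]_n) j : `|u 0 j| <= `|u|.
Proof.
rewrite [leRHS]/Num.Def.normr/= mx_normrE.
exact: (le_bigmax _ (fun ij : 'I_1 * 'I_n => `|u ij.1 ij.2|) (0, j)).
Qed.

Lemma rV_norm_le {R : realType} n (u : 'rV[R]_n) e :
  0 <= e -> (forall j, `|u 0 j| <= e) -> `|u| <= e.
Proof.
move=> e0 h; rewrite [leLHS]/Num.Def.normr/= mx_normrE; apply: bigmax_le => // -[i j] _.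
by rewrite /= ord1.
Qed.

(** * Mean value estimates *)
Section MeanValue.
Context {R : realType}.

Lemma near_normP n (u : 'rV[R]_n) (P : 'rV[R]_n -> Prop) :
  (\forall v \near u, P v) <->
  exists2 d : R, 0 < d & forall v, `|u - v| < d -> P v.
Proof. by split=> [/nbhs_normP[d d0 h]|[d d0 h]]; [|apply/nbhs_normP]; exists d. Qed.

Lemma derive_along_line n (f : 'rV[R]_n -> R) (x e : 'rV[R]_n) (t : R) :
  derivable f (t *: e + x) e ->
  is_derive t 1 (fun s : R => f (s *: e + x)) ('D_e f (t *: e + x)).
Proof.
have E : (fun h : R => h^-1 *: (((fun s : R => f (s *: e + x)) \o shift t) (h *: 1)
            - f (t *: e + x))) =
         (fun h : R => h^-1 *: ((f \o shift (t *: e + x)) (h *: e) - f (t *: e + x))).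
  apply/funext => h /=; congr (_ *: (f _ - _)).
  by rewrite [h *: 1]mulr1 scalerDl addrA.
by move=> h; split; rewrite /derivable /derive E.
Qed.

Lemma mean_value_line n (f : 'rV[R]_n -> R) (x e : 'rV[R]_n) (a b c eps : R) :
  a <= b ->
  (forall t, a <= t <= b -> derivable f (t *: e + x) e /\
     `|'D_e f (t *: e + x) - c| <= eps) ->
  `|f (b *: e + x) - f (a *: e + x) - c * (b - a)| <= eps * (b - a).
Proof.
move=> ab h.
have D t : t \in `[a, b]%R ->
    is_derive t 1 (fun s : R => f (s *: e + x)) ('D_e f (t *: e + x)).
  by rewrite in_itv /= => /h[ht _]; exact: derive_along_line.
have [|t /[!in_itv] /= tab ->] := MVT_segment ab (fun t ht => D t (subset_itv_oo_cc ht)).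
  by apply: derivable_within_continuous => t /D[].
rewrite -mulrBl normrM (ger0_norm (x := b - a)) ?subr_ge0//.
by rewrite ler_wpM2r ?subr_ge0//; have [] := h t tab.
Qed.

Lemma open_norm_ball n (u : 'rV[R]_n) (r : R) : open [set v | `|u - v| < r].
Proof.
rewrite openE => v /= uv; apply/near_normP; exists (r - `|u - v|).
  by rewrite subr_gt0.
move=> w; rewrite ltrBrDl; apply: le_lt_trans.
by rewrite -[u - w](subrKA v) ler_normD.
Qed.

Lemma rV_norm_lt n (u : 'rV[R]_n) e :
  0 < e -> (forall j, `|u 0 j| < e) -> `|u| < e.
Proof.
move=> e0 h; rewrite [ltLHS]/Num.Def.normr/= mx_normrE; apply: bigmax_lt => // -[i j] _.
by rewrite /= ord1.
Qed.

Lemma mean_value_segment n (f : 'rV[R]_n -> R) (x e : 'rV[R]_n) (a b c eps : R) :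
  (forall t, (a <= t <= b) || (b <= t <= a) -> derivable f (t *: e + x) e /\
     `|'D_e f (t *: e + x) - c| <= eps) ->
  `|f (b *: e + x) - f (a *: e + x) - c * (b - a)| <= eps * `|b - a|.
Proof.
move=> h; have [ab|/ltW ba] := leP a b.
  rewrite [`|b - a|]ger0_norm ?subr_ge0//; apply: mean_value_line => // t tab.
  by apply: h; rewrite tab.
rewrite [`|b - a|]distrC [`|a - b|]ger0_norm ?subr_ge0// -normrN.
rewrite [X in `|X|](_ : _ = f (a *: e + x) - f (b *: e + x) - c * (a - b)); last by ring.
by apply: mean_value_line => // t tab; apply: h; rewrite tab orbT.
Qed.

(** Two points of a ball for the supremum norm are joined by a path that changes
    the coordinates one at a time and stays in the ball; the one-dimensional
    mean value theorem applies to each step. *)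
Lemma mean_value_ball n (f : 'rV[R]_n -> R) (u0 : 'rV[R]_n) (d eps : R) (c : 'I_n -> R) :
  (forall v, `|u0 - v| < d -> forall j, derivable f v (delta_mx 0 j) /\
     `|'D_(delta_mx 0 j) f v - c j| <= eps) ->
  forall u u', `|u0 - u| < d -> `|u0 - u'| < d ->
  `|f u - f u' - \sum_j c j * (u 0 j - u' 0 j)| <= n%:R * eps * `|u - u'|.
Proof.
move=> h u u' ud u'd.
have d0 : 0 < d by apply: le_lt_trans ud.
(* the path from u' to u, after k of its steps *)
pose p k : 'rV[R]_n := \row_j (if (j < k)%N then u 0 j else u' 0 j).
have pn : p n = u by apply/rowP => j; rewrite mxE ltn_ord.
have p0 : p 0%N = u' by apply/rowP => j; rewrite mxE ltn0.
have -> : f u - f u' = \sum_(i < n) (f (p i.+1) - f (p i)).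
  by rewrite -[in LHS]pn -[in LHS]p0 -(telescope_sumr (fun k => f (p k)))// big_mkord.
rewrite -sumrB.
apply: le_trans (ler_norm_sum _ _ _) _.
rewrite -mulrA mulr_natl -[X in _ *+ X](card_ord n) -sumr_const.
apply: ler_sum => i _.
pose x : 'rV[R]_n := \row_j (if j == i then 0 else p i 0 j).
have E1 : p i.+1 = u 0 i *: delta_mx 0 i + x.
  apply/rowP => j; rewrite !mxE eqxx /= ltnS leq_eqVlt -val_eqE.
  by case: eqVneq => [/val_inj->|ne] /=; rewrite ?mulr1 ?addr0// mulr0 add0r.
have E0 : p i = u' 0 i *: delta_mx 0 i + x.
  apply/rowP => j; rewrite !mxE eqxx /=.
  by case: eqVneq => [->|ne] /=; rewrite ?ltnn ?mulr1 ?addr0// mulr0 add0r.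
have eps0 : 0 <= eps.
  by have [_] := h u ud i; exact: le_trans.
apply: le_trans (_ : eps * `|u 0 i - u' 0 i| <= _); last first.
  rewrite ler_wpM2l//; have := le_norm_coord (u - u') i.
  by rewrite !mxE.
rewrite E1 E0; apply: mean_value_segment => t ht; apply: h.
apply: rV_norm_lt => // j; rewrite !mxE eqxx /=.
have cu l : `|u0 0 l - u 0 l| < d.
  by apply: le_lt_trans ud; have := le_norm_coord (u0 - u) l; rewrite !mxE.
have cu' l : `|u0 0 l - u' 0 l| < d.
  by apply: le_lt_trans u'd; have := le_norm_coord (u0 - u') l; rewrite !mxE.
case: eqVneq => [->|ne] /=; last first.
  by rewrite mulr0 add0r; case: ifP.
rewrite mulr1 addr0; move: (cu i) (cu' i); rewrite !ltr_norml => /andP[a1 a2] /andP[b1 b2].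
by apply/andP; split; case/orP: ht => /andP[t1 t2]; lra.
Qed.

(** Strict differentiability: the estimate is uniform in both points. It gives
    the differentiability at u0 and the contraction in the local inverse
    theorem. *)
Lemma smooth_near_strict n (f : 'rV[R]_n -> R) (u0 : 'rV[R]_n) (eps : R) :
  smooth_near f u0 -> 0 < eps ->
  exists2 d, 0 < d & forall u u', `|u0 - u| < d -> `|u0 - u'| < d ->
  `|f u - f u' - \sum_j 'D_(delta_mx 0 j) f u0 * (u 0 j - u' 0 j)| <= eps * `|u - u'|.
Proof.
move=> fu0 eps0; (* the factor n of [mean_value_ball] may be 0 *)
pose e := eps / n.+1%:R.
have e0 : 0 < e by rewrite divr_gt0.
have : \forall v \near u0, forall j, derivable f v (delta_mx 0 j) /\
     `|'D_(delta_mx 0 j) f v - 'D_(delta_mx 0 j) f u0| <= e.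
  apply: near_forall => j.
  have := smooth_near_continuous (smooth_near_derive j fu0).
  move/cvgrPdist_le/(_ e e0); apply: filterS2 (smooth_near_near fu0) => v hv.
  by rewrite distrC => ?; split => //; exact: smooth_near_derivable.
move/near_normP => -[d d0 hd]; exists d => // u u' ud u'd.
apply: le_trans (mean_value_ball (eps := e) _ ud u'd) _.
  exact: hd.
rewrite ler_wpM2r// /e mulrCA ger_pMr// ler_pdivrMr// mul1r.
by rewrite ler_nat.
Qed.

Lemma zero_derive_locally_constant n (f : 'rV[R]_n -> R) (u0 : 'rV[R]_n) :
  (\forall v \near u0, forall j, derivable f v (delta_mx 0 j) /\
     'D_(delta_mx 0 j) f v = 0) ->
  \forall v \near u0, f v = f u0.
Proof.
move/near_normP => -[d d0 hd]; apply/near_normP; exists d => // u ud.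
have := @mean_value_ball _ f u0 d 0 (fun=> 0) _ u u0 ud.
rewrite subrr normr0 mulr0 mul0r big1 ?subr0; last by move=> j _; rewrite mul0r.
move=> /(_ _ d0); rewrite normr_le0 subr_eq0 => h; apply/eqP/h.
by move=> v vd j; have [? ->] := hd v vd j; rewrite subrr normr0.
Qed.

End MeanValue.

(** * Differentiability and composition *)
Lemma is_diff_approx {R : realType} (V W : normedModType R) (f : V -> W)
    (x : V) (L : {linear V -> W}) : continuous L ->
  (forall eps : R, 0 < eps ->
     \forall u \near x, `|f u - f x - L (u - x)| <= eps * `|u - x|) ->
  is_diff x f L.
Proof.
move=> Lc h.
have E : f \o shift x = cst (f x) + L +o_ (0 : V) id.
  apply/eqaddoP => e e0.
  have /nbhs_normP[d d0 hd] := h _ e0.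
  apply/nbhs_normP; exists d => // u /=; rewrite sub0r normrN => ud.
  have := hd (u + x); rewrite /= opprD addrCA subrr addr0 normrN addrK => /(_ ud).
  by rewrite -[X in `|X|]addrA -opprD.
have D := diff_unique Lc E.
by split=> //; apply/diff_locallyP; rewrite D; split.
Qed.

Section Differentiability.
Context {R : realType}.

Lemma rV_linear_bounded n (W : normedModType R) (L : {linear 'rV[R]_n -> W}) :
  exists2 C : R, 0 < C & forall v, `|L v| <= C * `|v|.
Proof.
exists (1 + \sum_j `|L (delta_mx 0 j)|); first by rewrite ltr_pwDl// sumr_ge0.
move=> v; rewrite [in leLHS](row_sum_delta v) linear_sum.
apply: le_trans (ler_norm_sum _ _ _) _.
rewrite mulrDl mul1r ler_wpDl// mulr_suml; apply: ler_sum => j _.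
by rewrite linearZ /= normrZ mulrC ler_wpM2l// le_norm_coord.
Qed.

Lemma rV_linear_continuous n (W : normedModType R) (L : {linear 'rV[R]_n -> W}) :
  continuous L.
Proof.
have [C C0 h] := rV_linear_bounded L.
move=> v; apply/(@cvgrPdist_le _ _ _ (nbhs v)) => e e0.
apply/near_normP; exists (e / C); first by rewrite divr_gt0.
move=> w vw; rewrite -linearB; apply: le_trans (h _) _.
by rewrite mulrC -ler_pdivlMr// ltW.
Qed.

Lemma is_diff_linear_approx n (W : normedModType R) (f : 'rV[R]_n -> W)
    (x : 'rV[R]_n) (L : {linear 'rV[R]_n -> W}) :
  (forall eps, 0 < eps ->
     \forall u \near x, `|f u - f x - L (u - x)| <= eps * `|u - x|) ->
  is_diff x f L.
Proof.
by move=> h; apply: is_diff_approx => //; exact: rV_linear_continuous.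
Qed.

Definition jac n m (f : 'rV[R]_n -> 'rV[R]_m) (u : 'rV[R]_n) : 'M[R]_(n, m) :=
  \matrix_(j, i) 'D_(delta_mx 0 j) (fun v => f v 0 i) u.

Lemma smooth_near_strict_rV n m (f : 'rV[R]_n -> 'rV[R]_m) (x : 'rV[R]_n) (eps : R) :
  smooth_near f x -> 0 < eps ->
  exists2 d, 0 < d & forall u u', `|x - u| < d -> `|x - u'| < d ->
  `|f u - f u' - (u - u') *m jac f x| <= eps * `|u - u'|.
Proof.
move=> /smooth_near_mxP h eps0.
suff H : \forall d \near (0:R)^'+, forall i u u', `|x - u| < d -> `|x - u'| < d ->
  `|(f u - f u' - (u - u') *m jac f x) 0 i| <= eps * `|u - u'|.
  have [d [/= d0 hd]] := filter_ex (filterI (nbhs_right_gt (0 : R)) H).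
  exists d => // u u' ud u'd; apply: rV_norm_le => [|i]; last exact: hd.
  by rewrite mulr_ge0// ltW.
apply: filter_forall => i; have [d d0 hd] := smooth_near_strict (h 0 i) eps0.
apply: filterS (nbhs_right_lt d0) => e ed u u' ue u'e.
have := hd u u' (lt_trans ue ed) (lt_trans u'e ed).
rewrite !mxE; congr (`|_ - _| <= _); apply: eq_bigr => j _.
by rewrite !mxE mulrC.
Qed.

Lemma smooth_near_is_diff n m (f : 'rV[R]_n -> 'rV[R]_m) (x : 'rV[R]_n) :
  smooth_near f x -> is_diff x f (mulmxr (jac f x)).
Proof.
move=> h; apply: is_diff_linear_approx => e e0.
have [d d0 hd] := smooth_near_strict_rV h e0.
by apply/near_normP; exists d => // u ud; apply: hd => //; rewrite subrr normr0.
Qed.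

Lemma smooth_near_is_diff_scalar n (f : 'rV[R]_n -> R) (x : 'rV[R]_n) :
  smooth_near f x -> differentiable f x /\
  forall v, 'd f x v = \sum_j v 0 j * 'D_(delta_mx 0 j) f x.
Proof.
move=> h; pose g v := \sum_j (v : 'rV[R]_n) 0 j * 'D_(delta_mx 0 j) f x.
have gl : linear g.
  move=> a u v; rewrite /g scaler_sumr -big_split; apply: eq_bigr => j _ /=.
  have -> : (a *: u + v) 0 j = a * u 0 j + v 0 j by rewrite !mxE.
  by rewrite mulrDl -mulrA.
pose L : {linear 'rV[R]_n -> R} := HB.pack g (GRing.isLinear.Build _ _ _ _ g gl).
suff [d1 d2] : is_diff x f L by split=> // v; rewrite d2.
apply: is_diff_linear_approx => e e0.
have [d d0 hd] := smooth_near_strict h e0.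
apply/near_normP; exists d => // u ud.
have := hd u x ud; rewrite subrr normr0 => /(_ d0).
congr (`|_ - _| <= _); apply: eq_bigr => j _; by rewrite !mxE mulrC.
Qed.

Lemma smooth_near_differentiable n m (f : 'rV[R]_n -> 'rV[R]_m) (x : 'rV[R]_n) :
  smooth_near f x -> differentiable f x.
Proof. by move=> /smooth_near_is_diff[]. Qed.

Lemma smooth_near_diffE n m (f : 'rV[R]_n -> 'rV[R]_m) (x v : 'rV[R]_n) :
  smooth_near f x -> 'd f x v = v *m jac f x.
Proof. by move=> /smooth_near_is_diff[_ ->]. Qed.

End Differentiability.

Section Composition.
Context {R : realType}.

Lemma Ck_sum n k (U : set 'rV[R]_n) (I : Type) (r : seq I) (F : I -> 'rV[R]_n -> R) :
  open U -> (forall i, Ck k U (F i)) -> Ck k U (fun v => \sum_(i <- r) F i v).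
Proof.
move=> oU h; elim: r => [|i r IH].
  by under eq_fun do rewrite big_nil; exact: Ck_cst.
by under eq_fun do rewrite big_cons; exact: (Ck_add oU (h i) IH).
Qed.

Lemma derive_comp_scalar n m (f : 'rV[R]_m -> R) (g : 'rV[R]_n -> 'rV[R]_m) u j :
  differentiable g u -> smooth_near f (g u) ->
  derivable (f \o g) u (delta_mx 0 j) /\
  'D_(delta_mx 0 j) (f \o g) u =
  \sum_l 'D_(delta_mx 0 l) f (g u) * 'D_(delta_mx 0 j) (fun v => g v 0 l) u.
Proof.
move=> dg hf; have [df dfE] := smooth_near_is_diff_scalar hf.
have dfg := differentiable_comp dg df.
split; first exact: diff_derivable.
rewrite deriveE// diff_comp//= dfE; apply: eq_bigr => l _.
rewrite mulrC -deriveE// derive_mx ?mxE//.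
exact: diff_derivable.
Qed.

(** The hypothesis on g stops at order k, so that the lemma applies to a local
    inverse while its smoothness is being proved by induction on the order. *)
Lemma Ck_comp n m k (U : set 'rV[R]_n) (W : set 'rV[R]_m)
    (f : 'rV[R]_m -> R) (g : 'rV[R]_n -> 'rV[R]_m) :
  open U -> open W -> (forall u, U u -> differentiable g u) ->
  (forall l, (l <= k)%N -> Ck l U g) -> Csmooth W f ->
  (forall u, U u -> W (g u)) -> Ck k U (f \o g).
Proof.
move=> oU oW dg + + UW; elim/ltn_ind: k f => -[|k] IH f gU fW.
  move=> u Uu; apply: continuous_comp; first exact: (gU 0%N).
  by apply: (fW 0%N); exact: UW.
have D u j : U u -> _ := fun Uu => derive_comp_scalar j (dg u Uu)
  (open_smooth_near oW (UW u Uu) fW).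
move=> j; split; first by move=> u /(D u j)[].
have H : Ck k U (fun u => \sum_l ((('D_(delta_mx 0 l) f) \o g) *
    'D_(delta_mx 0 j) (fun v => g v 0 l)) u).
  apply: Ck_sum => // l; apply: Ck_mul => // i ik.
    apply: IH => //; last exact: Csmooth_derive.
    by move=> l' l'i; apply: gU; apply: leq_trans l'i (leqW ik).
  by have /(Ck_mxP _ _ oU)/(_ 0 l)/(_ j)[] := gU i.+1 ik.
by apply: Ck_eq_open H => // u /(D u j)[_ ->].
Qed.

Lemma smooth_near_comp_scalar n m (f : 'rV[R]_m -> R) (g : 'rV[R]_n -> 'rV[R]_m) u :
  smooth_near g u -> smooth_near f (g u) -> smooth_near (f \o g) u.
Proof.
move=> hg /smooth_near_open[W [oW Wgu fW]].
have [U [oU Uu gU]] := smooth_near_open hg.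
pose U' := U `&` [set v | W (g v)]°.
have gU' : Csmooth U' g.
  by apply/Csmooth_set1P => v [Uv _]; move/Csmooth_set1P: gU; apply.
have oU' : open U' by apply: openI => //; exact: open_interior.
apply: (@open_smooth_near _ _ _ U') => //.
  split; first exact: Uu.
  by apply: (near_continuous (smooth_near_continuous hg)); exact: open_nbhs_nbhs.
move=> k; apply: (Ck_comp oU' oW) => //; last by move=> v [_ /nbhs_singleton].
by move=> v Uv; apply: smooth_near_differentiable; exact: open_smooth_near gU'.
Qed.

Lemma smooth_near_comp n m p q (f : 'rV[R]_m -> 'M[R]_(p, q)) (g : 'rV[R]_n -> 'rV[R]_m) u :
  smooth_near g u -> smooth_near f (g u) -> smooth_near (f \o g) u.
Proof.
move=> hg /smooth_near_mxP hf; apply/smooth_near_mxP => i j.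
exact: (smooth_near_comp_scalar hg (hf i j)).
Qed.

Lemma jac_comp n m p (f : 'rV[R]_m -> 'rV[R]_p) (g : 'rV[R]_n -> 'rV[R]_m) u :
  smooth_near g u -> smooth_near f (g u) ->
  jac (f \o g) u = jac g u *m jac f (g u).
Proof.
move=> hg hf; apply/matrixP => j i; rewrite !mxE.
move/smooth_near_mxP : hf => /(_ 0 i) hf.
have [_] := derive_comp_scalar j (smooth_near_differentiable hg) hf.
rewrite /comp => ->; apply: eq_bigr => l _; by rewrite !mxE mulrC.
Qed.

Lemma jac_near_eq n m (f g : 'rV[R]_n -> 'rV[R]_m) (u : 'rV[R]_n) :
  (\forall x \near u, f x = g x) -> jac f u = jac g u.
Proof.
move=> fg; apply/matrixP => j i; rewrite !mxE.
by apply: near_eq_derive; apply: filterS fg => x ->.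
Qed.

Lemma linear_smooth n m (L : {linear 'rV[R]_n -> 'rV[R]_m}) u :
  smooth_near L u /\ jac L u = lin1_mx L.
Proof.
have D v w : is_derive v w (fun x => L x) (L w).
  have := @is_diff_approx _ _ _ L v L (@rV_linear_continuous _ _ _ L).
  case=> [e e0|d1 d2].
    apply/near_normP; exists 1 => // x _.
    by rewrite -linearB subrr normr0 mulr_ge0// ltW.
  by split; [exact: diff_derivable|rewrite deriveE// d2].
split.
  apply: (@open_smooth_near _ _ _ setT) => //; first exact: openT.
  case=> [v _|k j]; first exact: rV_linear_continuous.
  split=> [v _|]; first exact: (ex_derive (is_derive := D v _)).
  apply: (@Ck_eq_open _ _ _ k setT (cst (L (delta_mx 0 j)))); first exact: openT.
    by move=> v _; rewrite (derive_val (is_derive := D v _)).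
  by apply: Ck_cst; exact: openT.
apply/matrixP => j i; rewrite !mxE.
have := derive_val (is_derive := D u (delta_mx 0 j)).
rewrite derive_mx ?(ex_derive (is_derive := D u (delta_mx 0 j)))//.
by move=> /matrixP/(_ 0 i); rewrite !mxE.
Qed.

End Composition.

Section MatrixFunctions.
Context {R : realType} {n : nat}.
Implicit Types u : 'rV[R]_n.

Lemma smooth_near_mulmx p q r (M : 'rV[R]_n -> 'M[R]_(p, q))
    (N : 'rV[R]_n -> 'M[R]_(q, r)) u :
  smooth_near M u -> smooth_near N u -> smooth_near (fun v => M v *m N v) u.
Proof.
move=> /smooth_near_mxP hM /smooth_near_mxP hN; apply/smooth_near_mxP => i j.
under eq_fun do rewrite mxE.
by apply: smooth_near_sum => l; exact: (smooth_nearM (hM i l) (hN l j)).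
Qed.

Lemma smooth_near_det p (M : 'rV[R]_n -> 'M[R]_p) u :
  smooth_near M u -> smooth_near (fun v => \det (M v)) u.
Proof.
move=> /smooth_near_mxP hM; rewrite /determinant.
apply: smooth_near_sum => s; apply: (smooth_nearM (smooth_near_cst _ _)).
by apply: smooth_near_prod => i; exact: hM.
Qed.

Lemma unitmx_near p (M : 'rV[R]_n -> 'M[R]_p) u :
  smooth_near M u -> M u \in unitmx -> \forall v \near u, M v \in unitmx.
Proof.
move=> hM; rewrite unitmxE unitfE => dM.
have := near_continuous (smooth_near_continuous (smooth_near_det hM))
  (open_nbhs_nbhs (conj (@open_neq _ (0 : R)) dM)).
by apply: filterS => v /= ?; rewrite unitmxE unitfE.
Qed.

Lemma smooth_near_invmx p (M : 'rV[R]_n -> 'M[R]_p) u :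
  smooth_near M u -> M u \in unitmx -> smooth_near (fun v => invmx (M v)) u.
Proof.
move=> hM uM; have dM : \det (M u) != 0 by rewrite -unitfE -unitmxE.
apply: (@smooth_near_eq _ _ _ (fun v => (\det (M v))^-1 *: \adj (M v))).
  by apply: filterS (unitmx_near hM uM) => v Mv; rewrite /invmx Mv.
apply/smooth_near_mxP => i j; under eq_fun do rewrite !mxE.
apply: (smooth_nearM (smooth_nearV (smooth_near_det hM) dM)).
apply: (smooth_nearM (smooth_near_cst _ _)).
apply: smooth_near_det; apply/smooth_near_mxP => k l; under eq_fun do rewrite !mxE.
by move/smooth_near_mxP: hM; apply.
Qed.

Lemma smooth_near_jac m (f : 'rV[R]_n -> 'rV[R]_m) u :
  smooth_near f u -> smooth_near (jac f) u.
Proof.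
move=> /smooth_near_mxP h; apply/smooth_near_mxP => j i; under eq_fun do rewrite !mxE.
exact/smooth_near_derive/h.
Qed.

End MatrixFunctions.

(** * The local inverse theorem *)
HB.instance Definition _ (R : realType) m n :=
  Complete.copy 'M[R]_(m, n) 'M[R]_(m, n).

Section LocalInverse.
Context {R : realType} {n : nat}.
Variables (Phi : 'rV[R]_n -> 'rV[R]_n) (u0 : 'rV[R]_n).
Hypotheses (Phi_smooth : smooth_near Phi u0) (jacPhi : jac Phi u0 = 1%:M).

Lemma local_inverse_ball : exists2 d : R, 0 < d &
  [/\ forall u u', `|u0 - u| < d -> `|u0 - u'| < d ->
        `|Phi u - Phi u' - (u - u')| <= 2^-1 * `|u - u'|,
      forall u, `|u0 - u| < d -> smooth_near Phi u &
      forall u, `|u0 - u| < d -> jac Phi u \in unitmx].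
Proof.
have half0 : 0 < 2^-1 :> R by rewrite invr_gt0.
have [d d0 hd] := smooth_near_strict_rV Phi_smooth half0.
have /near_normP[d1 d10 hd1] := smooth_near_near Phi_smooth.
have : jac Phi u0 \in unitmx by rewrite jacPhi unitmx1.
move=> /(unitmx_near (smooth_near_jac Phi_smooth)) /near_normP[d2 d20 hd2].
exists (Num.min d (Num.min d1 d2)); first by rewrite !lt_min d0 d10.
by split=> [u u'|u|u]; rewrite !lt_min => /and3P[ud ud1 ud2];
  [move=> /and3P[u'd _ _]; have := hd u u' ud u'd; rewrite jacPhi mulmx1|exact: hd1|exact: hd2].
Qed.

(** Solving Phi u = y amounts to finding a fixed point of u |-> y - (Phi u - u),
    which contracts by 1/2 near u0. The inverse Psi is 2-Lipschitz, hence
    differentiable with derivative the inverse of that of Phi at Psi y; this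
    formula expresses the derivatives of Psi smoothly through Psi, and the
    order of smoothness increases by one at each use. *)
Lemma local_inverse : exists Psi : 'rV[R]_n -> 'rV[R]_n,
  [/\ smooth_near Psi (Phi u0), Psi (Phi u0) = u0,
      \forall u \near u0, Psi (Phi u) = u &
      \forall y \near Phi u0, Phi (Psi y) = y].
Proof.
have [d d0 [lip sm un]] := local_inverse_ball.
have surj y : `|Phi u0 - y| < d / 4 -> exists u, `|u0 - u| < d /\ Phi u = y.
  (* the contraction maps the ball of radius d/2 to itself: d/4 bounds the
     displacement of y and (d/2)/2 that of u *)
  move=> yd; pose U := [set u | `|u0 - u| <= d / 2].
  have d2 : d / 2 < d by rewrite ltr_pdivrMr// ltr_pMr// ltr1n.
  pose g u := y - (Phi u - u).
  have gU : set_fun U U g.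
    move=> u; rewrite /U/= => ud; have := lip u u0 (le_lt_trans ud d2).
    rewrite subrr normr0 => /(_ d0) h.
    have -> : u0 - g u = (Phi u0 - y) + (Phi u - Phi u0 - (u - u0)).
      by rewrite /g; apply/rowP => j; rewrite !mxE; ring.
    apply: le_trans (ler_normD _ _) _.
    have : `|u - u0| <= d / 2 by rewrite distrC.
    by lra.
  pose gf : {fun U >-> U} := mkfun gU.
  have ctr : is_contraction gf.
    exists (2^-1)%:nng; split; first by rewrite /= invf_lt1// ltr1n.
    move=> [u u'] [/= Uu Uu']; rewrite /g.
    rewrite [X in `|X|](_ : _ = - (Phi u - Phi u' - (u - u'))); last first.
      by apply/rowP => j; rewrite !mxE; ring.
    by rewrite normrN; apply: lip; [exact: le_lt_trans Uu d2|exact: le_lt_trans Uu' d2].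
  have [] := @banach_fixed_point R 'rV[R]_n U gf ctr.
  - exact: closed_closed_ball_.
  - by exists u0; rewrite /U/= subrr normr0 divr_ge0// ltW.
  - move=> u Uu uE; exists u; split; first exact: le_lt_trans Uu d2.
    have {}uE : u = g u := uE.
    apply/eqP; rewrite eq_sym -subr_eq0; apply/eqP.
    have -> : y - Phi u = g u - u by apply/rowP => j; rewrite /g !mxE; ring.
    by rewrite -uE subrr.
have expand u u' : `|u0 - u| < d -> `|u0 - u'| < d ->
    `|u - u'| <= 2 * `|Phi u - Phi u'|.
  move=> ud u'd; have := lip u u' ud u'd; set a := `|u - u'|.
  rewrite distrC => h; have : a <= `|u - u' - (Phi u - Phi u')| + `|Phi u - Phi u'|.
    by rewrite -[X in X <= _]/`|u - u'| -[in leLHS](subrK (Phi u - Phi u') (u - u')) ler_normD.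
  lra.
have inj u u' : `|u0 - u| < d -> `|u0 - u'| < d -> Phi u = Phi u' -> u = u'.
  move=> ud u'd e; apply/eqP; rewrite -subr_eq0 -normr_le0.
  by apply: le_trans (expand u u' ud u'd) _; rewrite e subrr normr0 mulr0.
pose Psi y := get [set u | `|u0 - u| < d /\ Phi u = y].
have PsiP y : `|Phi u0 - y| < d / 4 -> `|u0 - Psi y| < d /\ Phi (Psi y) = y.
  move/surj => -[u hu].
  exact: (@getPex _ [set u | `|u0 - u| < d /\ Phi u = y] (ex_intro _ u hu)).
have u0d : `|u0 - u0| < d by rewrite subrr normr0.
have Phi0 : `|Phi u0 - Phi u0| < d / 4 by rewrite subrr normr0 divr_gt0.
have nearball : \forall y \near Phi u0, `|Phi u0 - y| < d / 4.
  by apply/near_normP; exists (d / 4) => //; rewrite divr_gt0.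
exists Psi; split.
- have oO : open [set y | `|Phi u0 - y| < d / 4].
    exact: open_norm_ball.
  have oW : open [set u | `|u0 - u| < d] by exact: open_norm_ball.
  have PsiLip y y' : `|Phi u0 - y| < d / 4 -> `|Phi u0 - y'| < d / 4 ->
      `|Psi y - Psi y'| <= 2 * `|y - y'|.
    by move=> /PsiP[h1 e1] /PsiP[h2 e2]; have := expand _ _ h1 h2; rewrite e1 e2.
  have dPsi y : `|Phi u0 - y| < d / 4 ->
      is_diff y Psi (mulmxr (invmx (jac Phi (Psi y)))).
    move=> yO; have [yd ye] := PsiP y yO; set A := jac Phi (Psi y).
    have uA : A \in unitmx by exact: un.
    have [C C0 hC] := rV_linear_bounded (mulmxr (invmx A) : {linear 'rV[R]_n -> 'rV[R]_n}).
    apply: is_diff_linear_approx => e e0.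
    pose e' := e / (2 * C); have e'0 : 0 < e' by rewrite divr_gt0// mulr_gt0.
    have [r r0 hr] := smooth_near_strict_rV (sm _ yd) e'0.
    have cPsi : \forall y' \near y, `|Psi y - Psi y'| < r.
      have : \forall y' \near y, `|Phi u0 - y'| < d / 4 by exact: open_nbhs_nbhs.
      have : \forall y' \near y, `|y - y'| < r / 2.
        by apply/near_normP; exists (r / 2) => //; rewrite divr_gt0.
      apply: filterS2 => y' yy' y'O; apply: le_lt_trans (PsiLip _ _ yO y'O) _.
      by rewrite mulrC -ltr_pdivlMr.
    have : \forall y' \near y, `|Phi u0 - y'| < d / 4 by exact: open_nbhs_nbhs.
    apply: filterS2 cPsi => y' y'r y'O; have [y'd y'e] := PsiP y' y'O.
    have E : Psi y' - Psi y - mulmxr (invmx A) (y' - y) =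
        mulmxr (invmx A) (- (Phi (Psi y') - Phi (Psi y) - (Psi y' - Psi y) *m A)).
      have aux (w z : 'rV[R]_n) : w - z *m invmx A = (- (z - w *m A)) *m invmx A.
        by rewrite mulNmx mulmxBl mulmxK// opprB.
      rewrite y'e ye; exact: aux.
    rewrite E; apply: le_trans (hC _) _; rewrite normrN.
    have := hr (Psi y') (Psi y) y'r; rewrite subrr normr0 => /(_ r0) h1.
    have h2 := PsiLip _ _ y'O yO.
    have -> : e * `|y' - y| = C * (e' * (2 * `|y' - y|)).
      by rewrite /e'; field; rewrite gt_eqF.
    apply: ler_wpM2l; first exact: ltW.
    by apply: le_trans h1 _; apply: ler_wpM2l => //; exact: ltW.
  apply: (open_smooth_near oO Phi0) => k; elim/ltn_ind: k => -[|k] IH.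
    by move=> y /dPsi[+ _]; exact: differentiable_continuous.
  move=> j; split; first by move=> y /dPsi[+ _]; exact: diff_derivable.
  apply: (@Ck_eq_open _ _ _ k _ (fun y => row j (invmx (jac Phi (Psi y))))) => //.
    by move=> y /dPsi[d1 d2]; rewrite deriveE// d2 /= rowE.
  apply/(Ck_mxP _ _ oO) => i l.
  apply: (@Ck_comp _ _ _ k _ _ (fun u => row j (invmx (jac Phi u)) i l) Psi oO oW) => //.
  + by move=> y /dPsi[].
  + apply/(smooth_nearP _ oW) => u ud; under eq_fun do rewrite mxE.
    by have /smooth_near_mxP := smooth_near_invmx (smooth_near_jac (sm u ud)) (un u ud); apply.
  + by move=> y /PsiP[].
- by have [? ?] := PsiP _ Phi0; apply: inj.
- have nu : \forall u \near u0, `|u0 - u| < d by apply/near_normP; exists d.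
  have := near_continuous (smooth_near_continuous Phi_smooth) nearball.
  apply: filterS2 nu => u ud /PsiP[? ?]; exact: inj.
- by apply: filterS nearball => y /PsiP[].
Qed.

End LocalInverse.

(** * Linear systems of constant rank *)
Section ConstantRank.
Context {R : realType} {n : nat}.
Implicit Types u : 'rV[R]_n.

Lemma smooth_nearD_mx p q (M N : 'rV[R]_n -> 'M[R]_(p, q)) u :
  smooth_near M u -> smooth_near N u -> smooth_near (fun v => M v + N v) u.
Proof.
move=> /smooth_near_mxP hM /smooth_near_mxP hN; apply/smooth_near_mxP => i j.
by under eq_fun do rewrite mxE; exact: (smooth_nearD (hM i j) (hN i j)).
Qed.

(** With L and U the outer factors of the echelon form M0 = L E U and r the rank
    of M0, the two constant matrices below make J M + K invertible for M close
    to M0: it is U at M0. The first r rows of J M + K are rows of J M, so J M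
    keeps rank r, and the last ones come from K. *)
Section EchelonPencil.
Context {p q : nat} (M0 : 'M[R]_(p, q)).

Definition echelonJ : 'M[R]_(q, p) :=
  pid_mx (\rank M0) *m invmx (col_ebase M0).
Definition echelonK : 'M[R]_q := copid_mx (\rank M0) *m row_ebase M0.

Let le_rank_p := rank_leq_row M0.
Let le_rank_q := rank_leq_col M0.

Lemma echelon_unit : echelonJ *m M0 + echelonK = row_ebase M0.
Proof.
rewrite /echelonJ /echelonK -mulmxA -[X in invmx _ *m X](mulmx_ebase M0).
rewrite -mulmxA mulKmx ?col_ebase_unit// mulmxA pid_mx_id//.
by rewrite /copid_mx mulmxBl mul1mx addrC subrK.
Qed.

Lemma echelon_proj (M : 'M[R]_(p, q)) :
  pid_mx (\rank M0) *m (echelonJ *m M + echelonK) = echelonJ *m M :> 'M[R]_q.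
Proof.
rewrite mulmxDr /echelonK [X in _ + X]mulmxA mul_pid_mx_copid// mul0mx addr0.
by rewrite /echelonJ !mulmxA pid_mx_id.
Qed.

Lemma rank_echelon (M : 'M[R]_(p, q)) :
  echelonJ *m M + echelonK \in unitmx -> \rank (echelonJ *m M) = \rank M0.
Proof.
move=> uG; rewrite -echelon_proj mxrankMfree ?rank_pid_mx//.
by rewrite row_free_unit.
Qed.

End EchelonPencil.

Lemma echelon_unit_near p q (M : 'rV[R]_n -> 'M[R]_(p, q)) u0 :
  smooth_near M u0 ->
  smooth_near (fun u => echelonJ (M u0) *m M u + echelonK (M u0)) u0 /\
  \forall u \near u0, echelonJ (M u0) *m M u + echelonK (M u0) \in unitmx.
Proof.
move=> hM.
have hG : smooth_near (fun u => echelonJ (M u0) *m M u + echelonK (M u0)) u0.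
  apply: smooth_nearD_mx; last exact: smooth_near_cst.
  by apply: smooth_near_mulmx => //; exact: smooth_near_cst.
split=> //; apply: (unitmx_near hG).
by rewrite echelon_unit row_ebase_unit.
Qed.

Lemma rank_lower_semicontinuous p q (M : 'rV[R]_n -> 'M[R]_(p, q)) u0 :
  smooth_near M u0 -> \forall u \near u0, (\rank (M u0) <= \rank (M u))%N.
Proof.
move=> /echelon_unit_near[_]; apply: filterS => u /rank_echelon <-.
exact: mxrankM_maxr.
Qed.

(** As J M(u) has the rank of M(u), it has the same row space, and the system
    M w = b is equivalent to J M w = J b as soon as b is compatible. The latter
    is completed by K w = K a into an invertible system, so that the solution
    takes at u0 the prescribed value a, if a is a solution there. *)
Lemma smooth_linear_solution p q (M : 'rV[R]_n -> 'M[R]_(p, q))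
    (b : 'rV[R]_n -> 'cV[R]_p) u0 (a : 'cV[R]_q) :
  smooth_near M u0 -> smooth_near b u0 ->
  (\forall u \near u0, (\rank (M u) <= \rank (M u0))%N) ->
  (\forall u \near u0, forall z : 'rV_p, z *m M u = 0 -> z *m b u = 0) ->
  exists w : 'rV[R]_n -> 'cV[R]_q,
    [/\ smooth_near w u0, \forall u \near u0, M u *m w u = b u &
        M u0 *m a = b u0 -> w u0 = a].
Proof.
move=> hM hb rkM ker; have [hG uG] := echelon_unit_near hM.
set J := echelonJ (M u0) in hG uG; set K := echelonK (M u0) in hG uG.
exists (fun u => invmx (J *m M u + K) *m (J *m b u + K *m a)); split.
- apply: smooth_near_mulmx; first exact: smooth_near_invmx hG (nbhs_singleton uG).
  apply: smooth_nearD_mx; last exact: smooth_near_cst.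
  by apply: smooth_near_mulmx => //; exact: smooth_near_cst.
- apply: filterS (filterI uG (filterI rkM ker)) => u [uGu [rku keru]].
  set w := invmx _ *m _.
  have Gw : (J *m M u + K) *m w = J *m b u + K *m a by rewrite mulKVmx.
  have JMw : J *m M u *m w = J *m b u.
    have /(congr1 (mulmx (pid_mx (\rank (M u0)) : 'M_q))) := Gw.
    rewrite mulmxA echelon_proj mulmxDr => ->.
    rewrite [X in _ + X](_ : _ = 0) ?addr0.
      by rewrite mulmxA /J /echelonJ mulmxA pid_mx_id ?rank_leq_col.
    by rewrite mulmxA /K /echelonK mulmxA mul_pid_mx_copid ?rank_leq_col// !mul0mx.
  have [C MC] : exists C, M u = C *m (J *m M u).
    apply/submxP; have /mxrank_leqif_sup[_ <-] := submxMl J (M u).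
    rewrite eqn_leq; apply/andP; split; first exact: mxrankM_maxr.
    by rewrite rank_echelon.
  rewrite {1}MC -mulmxA JMw mulmxA; apply/eqP; rewrite eq_sym -subr_eq0.
  rewrite -[X in X - _]mul1mx -mulmxBl; apply/eqP/row_matrixP => i.
  rewrite row_mul row0; apply: keru.
  by rewrite -row_mul mulmxBl mul1mx -mulmxA -MC subrr row0.
- move=> h; rewrite -h mulmxA -mulmxDl mulKmx//; exact: (nbhs_singleton uG).
Qed.

End ConstantRank.

(** * Jacobian matrices and gradients *)
Section JacobianRules.
Context {R : realType}.

Lemma smooth_nearD_rV n m (f g : 'rV[R]_n -> 'rV[R]_m) u :
  smooth_near f u -> smooth_near g u ->
  smooth_near (fun v => f v + g v) u /\
  jac (fun v => f v + g v) u = jac f u + jac g u.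
Proof.
move=> hf hg; split; first exact: smooth_nearD_mx.
move/smooth_near_mxP : hf => hf; move/smooth_near_mxP : hg => hg.
apply/matrixP => j i; rewrite !mxE.
have -> : (fun v => (f v + g v) 0 i) = (fun v => f v 0 i) + (fun v => g v 0 i).
  by apply/funext => v; rewrite mxE.
by rewrite deriveD//; exact: smooth_near_derivable.
Qed.

Lemma jac_cst n m (c : 'rV[R]_m) (u : 'rV[R]_n) : jac (cst c) u = 0.
Proof. by apply/matrixP => j i; rewrite !mxE derive_cst. Qed.

Lemma smooth_near_mulmxr n m p (f : 'rV[R]_n -> 'rV[R]_m) (A : 'M[R]_(m, p)) u :
  smooth_near f u ->
  smooth_near (fun v => f v *m A) u /\ jac (fun v => f v *m A) u = jac f u *m A.
Proof.
move=> hf; have [lA jA] := linear_smooth (mulmxr A : {linear 'rV[R]_m -> 'rV[R]_p}) (f u).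
split; first exact: (smooth_near_comp (f := mulmxr A) hf).
rewrite -[LHS]/(jac (mulmxr A \o f) u) jac_comp// jA; congr (_ *m _).
by apply/row_matrixP => i; rewrite !rowE mul_rV_lin1.
Qed.

Lemma smooth_near_id n (u : 'rV[R]_n) :
  smooth_near (fun v : 'rV[R]_n => v) u /\ jac (fun v => v) u = 1%:M.
Proof.
have [? jA] := linear_smooth (idfun : {linear 'rV[R]_n -> 'rV[R]_n}) u.
split=> //; rewrite -[LHS]/(jac idfun u) jA.
by apply/row_matrixP => i; rewrite !rowE mul_rV_lin1 mulmx1.
Qed.

Definition grad n (f : 'rV[R]_n -> R) u : 'cV[R]_n :=
  \col_j 'D_(delta_mx 0 j) f u.

Lemma smooth_near_grad n (f : 'rV[R]_n -> R) u :
  smooth_near f u -> smooth_near (grad f) u.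
Proof.
move=> hf; apply/smooth_near_mxP => j i; under eq_fun do rewrite !mxE.
exact: smooth_near_derive.
Qed.

Lemma grad_comp n m (f : 'rV[R]_m -> R) (g : 'rV[R]_n -> 'rV[R]_m) u :
  smooth_near g u -> smooth_near f (g u) ->
  grad (f \o g) u = jac g u *m grad f (g u).
Proof.
move=> hg hf; apply/colP => j; rewrite !mxE.
have [_ ->] := derive_comp_scalar j (smooth_near_differentiable hg) hf.
by apply: eq_bigr => l _; rewrite !mxE mulrC.
Qed.

Lemma gradD n (f g : 'rV[R]_n -> R) u :
  smooth_near f u -> smooth_near g u -> grad (f + g) u = grad f u + grad g u.
Proof.
by move=> hf hg; apply/colP => j; rewrite !mxE deriveD//; exact: smooth_near_derivable.
Qed.

Lemma gradM n (f g : 'rV[R]_n -> R) u : smooth_near f u -> smooth_near g u ->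
  grad (f * g) u = f u *: grad g u + g u *: grad f u.
Proof.
by move=> hf hg; apply/colP => j; rewrite !mxE deriveM//; exact: smooth_near_derivable.
Qed.

Lemma grad_sum n (I : Type) (r : seq I) (F : I -> 'rV[R]_n -> R) u :
  (forall i, smooth_near (F i) u) ->
  grad (fun v => \sum_(i <- r) F i v) u = \sum_(i <- r) grad (F i) u.
Proof.
move=> h; elim: r => [|i r IH].
  under eq_fun do rewrite big_nil.
  by rewrite big_nil; apply/colP => j; rewrite !mxE derive_cst.
under eq_fun do rewrite big_cons.
by rewrite big_cons -IH -gradD//; exact: smooth_near_sum.
Qed.

Lemma grad_near_eq n (f g : 'rV[R]_n -> R) (u : 'rV[R]_n) :
  (\forall x \near u, f x = g x) -> grad f u = grad g u.
Proof. by move=> fg; apply/colP => j; rewrite !mxE; exact: near_eq_derive. Qed.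

Lemma grad_cst n (c : R) (u : 'rV[R]_n) : grad (cst c) u = 0.
Proof. by apply/colP => j; rewrite !mxE derive_cst. Qed.

End JacobianRules.

(** * Submersions and immersions in coordinates *)
Section NormalForms.
Context {R : realType}.

(** Correcting the identity by a right inverse A of the derivative, that is with
    Phi u = u + (p u - p u0 - (u - u0) D) A, gives Phi derivative 1 at u0 and
    p u = p u0 + (Phi u - u0) D: the map p is affine in the coordinates Phi,
    without any splitting of the variables. *)
Lemma submersion_straighten s q (p : 'rV[R]_s -> 'rV[R]_q) u0 (A : 'M[R]_(q, s)) :
  smooth_near p u0 -> A *m jac p u0 = 1%:M ->
  exists Phi Psi : 'rV[R]_s -> 'rV[R]_s,
    [/\ smooth_near Phi u0 /\ smooth_near Psi u0, jac Phi u0 = 1%:M,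
      Phi u0 = u0 /\ Psi u0 = u0,
      (\forall u \near u0, Psi (Phi u) = u) /\
      (\forall y \near u0, Phi (Psi y) = y) &
      \forall y \near u0, p (Psi y) = p u0 + (y - u0) *m jac p u0].
Proof.
move=> hp AD; set D := jac p u0 in AD *.
pose Phi u := (p u + (u *m (- D) + cst (u0 *m D - p u0) u)) *m A + u.
have PhiE u : Phi u *m D = p u - p u0 + u0 *m D.
  rewrite /Phi mulmxDl -mulmxA AD mulmx1 mulmxN.
  by rewrite /cst addrA addrAC subrK addrA addrAC.
have [s1 j1] := smooth_near_id u0.
have [s2 j2] := smooth_near_mulmxr (- D) s1.
have [s3 j3] := smooth_nearD_rV s2 (smooth_near_cst (u0 *m D - p u0) u0).
have [s4 j4] := smooth_nearD_rV hp s3.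
have [s5 j5] := smooth_near_mulmxr A s4.
have [sPhi jPhi] := smooth_nearD_rV s5 s1.
have jPhi1 : jac Phi u0 = 1%:M.
  by rewrite /Phi jPhi j5 j4 j3 j2 j1 jac_cst addr0 mul1mx subrr mul0mx add0r.
have Phi0 : Phi u0 = u0.
  by rewrite /Phi /cst mulmxN addKr subrr mul0mx add0r.
have [Psi [sPsi]] := local_inverse (Phi := Phi) sPhi jPhi1.
rewrite Phi0 in sPsi * => Psi0 PsiK PhiK.
exists Phi, Psi; split => //.
apply: filterS PhiK => y yE; rewrite -[in RHS]yE mulmxBl PhiE.
by rewrite addrK addrC subrK.
Qed.

(** A left inverse A of the derivative turns f into a local diffeomorphism
    u |-> f u A, and its inverse after A retracts onto the image of f. *)
Lemma immersion_retraction s n (f : 'rV[R]_s -> 'rV[R]_n) u0 (A : 'M[R]_(n, s)) :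
  smooth_near f u0 -> jac f u0 *m A = 1%:M ->
  exists r : 'rV[R]_n -> 'rV[R]_s,
    smooth_near r (f u0) /\ \forall u \near u0, r (f u) = u.
Proof.
move=> hf fA; have [sPhi jPhi] := smooth_near_mulmxr A hf.
have [Psi [sPsi _ PsiK _]] := local_inverse sPhi (etrans jPhi fA).
exists (Psi \o mulmxr A); split => //.
apply: smooth_near_comp => //.
by have [] := linear_smooth (mulmxr A : {linear 'rV[R]_n -> 'rV[R]_s}) (f u0).
Qed.

(** The extension is h (r x) + (x - f (r x)) w (r x). At x = f u the second term
    vanishes and contributes (1 - dr df) w to the gradient, while the first
    contributes dr dh = dr df w; the total is w u. *)
Lemma prescribed_extension s n (f : 'rV[R]_s -> 'rV[R]_n) u0
    (r : 'rV[R]_n -> 'rV[R]_s) (h : 'rV[R]_s -> R) (w : 'rV[R]_s -> 'cV[R]_n) :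
  smooth_near f u0 -> smooth_near r (f u0) -> (\forall u \near u0, r (f u) = u) ->
  smooth_near h u0 -> smooth_near w u0 ->
  (\forall u \near u0, jac f u *m w u = grad h u) ->
  exists F : 'rV[R]_n -> R, smooth_near F (f u0) /\
    \forall u \near u0, F (f u) = h u /\ grad F (f u) = w u.
Proof.
move=> hf hr rK hh hw fw.
pose c l (x : 'rV[R]_n) : R := x 0 l.
pose d l (x : 'rV[R]_n) : R := f (r x) 0 l.
pose e l (x : 'rV[R]_n) : R := w (r x) l 0.
pose b l : 'rV[R]_n -> R := c l - d l.
pose F : 'rV[R]_n -> R := (h \o r) + (fun x => \sum_l (e l * b l) x).
have main u : smooth_near f u -> smooth_near r (f u) -> r (f u) = u ->
    smooth_near h u -> smooth_near w u -> jac f u *m w u = grad h u ->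
    smooth_near F (f u) /\ (F (f u) = h u /\ grad F (f u) = w u).
  move=> {}hf {}hr {}rK {}hh {}hw {}fw.
  have sfr : smooth_near (f \o r) (f u) by apply: smooth_near_comp => //; rewrite rK.
  have sid l : smooth_near (c l) (f u).
    by have [/smooth_near_mxP h1 _] := smooth_near_id (f u); exact: h1.
  have sfrl l : smooth_near (d l) (f u).
    by move/smooth_near_mxP: sfr; apply.
  have sb l : smooth_near (b l) (f u).
    by apply: smooth_nearD; [exact: sid|apply: smooth_nearN; exact: sfrl].
  have sw l : smooth_near (e l) (f u).
    have /smooth_near_mxP : smooth_near (w \o r) (f u) by apply: smooth_near_comp => //; rewrite rK.
    exact.
  have swb l : smooth_near (e l * b l) (f u) by exact: smooth_nearM.
  have shr : smooth_near (h \o r) (f u) by apply: smooth_near_comp_scalar => //; rewrite rK.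
  have b0 l : b l (f u) = 0.
    by rewrite -[LHS]/(f u 0 l - f (r (f u)) 0 l) rK subrr.
  have eE l : e l (f u) = w u l 0 by rewrite /e rK.
  split; first by apply: smooth_nearD => //; exact: smooth_near_sum.
  split.
    rewrite -[LHS]/(h (r (f u)) + \sum_l (e l (f u) * b l (f u))) rK.
    by rewrite big1 ?addr0// => l _; rewrite b0 mulr0.
  rewrite /F gradD//; last exact: smooth_near_sum.
  rewrite grad_sum// grad_comp ?rK// -fw.
  have gb l : grad (b l) (f u) = col l (1%:M - jac r (f u) *m jac f u).
    have jfr : jac (f \o r) (f u) = jac r (f u) *m jac f u by rewrite jac_comp ?rK.
    rewrite -jfr; have [_ jid] := smooth_near_id (f u); rewrite -jid.
    apply/colP => j; rewrite !mxE /b deriveB//; exact: smooth_near_derivable.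
  under eq_bigr do rewrite gradM// b0 scale0r addr0 gb eE.
  have -> : \sum_l w u l 0 *: col l (1%:M - jac r (f u) *m jac f u) =
      (1%:M - jac r (f u) *m jac f u) *m w u.
    apply/colP => j; rewrite mxE summxE; apply: eq_bigr => l _.
    by rewrite [LHS]mxE [col _ _ _ _]mxE mulrC.
  by rewrite mulmxBl mul1mx !mulmxA addrC subrK.
exists F; split.
  by have [] := main u0 hf hr (nbhs_singleton rK) hh hw (nbhs_singleton fw).
have hr' : \forall u \near u0, smooth_near r (f u).
  exact: (near_continuous (smooth_near_continuous hf) (smooth_near_near hr)).
near=> u.
have [] := main u; last by [].
- by near: u; exact: smooth_near_near.
- by near: u.
- by near: u.
- by near: u; exact: smooth_near_near.
- by near: u; exact: smooth_near_near.
- by near: u.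
Unshelve. all: by end_near. Qed.

End NormalForms.

Local Notation cdomn y := (cdom (mchart y)).
Local Notation cm y := (cmap (mchart y)).
Local Notation ci y := (cinv (mchart y)).

(** * Smooth functions in charts *)
Section ChartLemmas.
Context {R : realType}.

Lemma chart_cinvK (M : topologicalType) (c : chart R M) u :
  (cmap c @` cdom c) u -> cdom c (cinv c u) /\ cmap c (cinv c u) = u.
Proof. by case=> x cx <-; rewrite cmapK. Qed.

Lemma chart_near (M : topologicalType) (c : chart R M) x : cdom c x ->
  \forall u \near cmap c x, cdom c (cinv c u) /\ cmap c (cinv c u) = u.
Proof.
move=> cx; have : (cmap c @` cdom c) (cmap c x) by exists x.
move=> /(open_near (@cimg_open _ _ c)); apply: filterS => u.
exact: chart_cinvK.
Qed.

Lemma chart_near_inv (M : topologicalType) (c : chart R M) x (U : set M) :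
  cdom c x -> nbhs x U -> \forall u \near cmap c x, U (cinv c u).
Proof.
move=> cx xU; apply: (near_continuous (f := cinv c)).
  by apply: cinv_cont; exists x.
by rewrite cmapK.
Qed.

Lemma chart_near_pull (M : topologicalType) (c : chart R M) x (P : 'rV[R]_(cdim c) -> Prop) :
  cdom c x -> (\forall u \near cmap c x, P u) -> \forall y \near x, cdom c y /\ P (cmap c y).
Proof.
move=> cx xP; apply: filterI; first exact: (open_near (@cdom_open _ _ c)).
exact: (near_continuous (cmap_cont cx) xP).
Qed.

Lemma chart_img_open (M : topologicalType) (c : chart R M) (U : set M) :
  open U -> open (cmap c @` (cdom c `&` U)).
Proof.
move=> oU; rewrite openE => _ [x [cx Ux] <-].
suff : \forall u \near cmap c x, (cmap c @` (cdom c `&` U)) u by [].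
apply: filterS2 (chart_near cx) (chart_near_inv cx (open_near oU Ux)).
by move=> u [cu uE] Uu; exists (cinv c u).
Qed.

Lemma mem_chart (M : manifold R) (x : M) : cdomn x x.
Proof. exact: mem_chart_at. Qed.
#[local] Hint Resolve mem_chart : core.

(** This holds when V is R or a space of matrices; as a property of V, it lets
    the lemmas below serve functions and coordinate maps alike. *)
Definition comp_stable (V : normedModType R) := forall n m (f : 'rV[R]_m -> V)
  (g : 'rV[R]_n -> 'rV[R]_m) u,
  smooth_near g u -> smooth_near f (g u) -> smooth_near (f \o g) u.

Lemma comp_stable_scalar : comp_stable R.
Proof. by move=> n m f g u; exact: smooth_near_comp_scalar. Qed.

Lemma comp_stable_mx p q : comp_stable 'M[R]_(p, q).
Proof. by move=> n m f g u; exact: smooth_near_comp. Qed.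

(** Source of all chain rules below: near the point, composition of maps between
    manifolds is composition of their coordinate expressions. *)
Lemma comp_in_charts (M N : manifold R) (T : Type) (f : M -> N) (g : N -> T)
    (z : M) (y : N) (x : M) :
  {for x, continuous f} -> cdomn z x -> cdomn y (f x) ->
  \forall u \near cm z x, ((g \o ci y) \o (cm y \o f \o ci z)) u = (g \o f \o ci z) u.
Proof.
move=> fx zx yfx.
have := chart_near_inv zx (near_continuous fx (open_near (cdom_open (mchart y)) yfx)).
by apply: filterS => u /= yu; rewrite cmapK.
Qed.

Lemma transition_smooth (M : manifold R) (y z x : M) : cdomn y x -> cdomn z x ->
  smooth_near (cm z \o ci y) (cm y x).
Proof.
move=> yx zx; apply: (open_smooth_near _ _ (chart_compat (mstruct M) y z)).
  by apply: chart_img_open; exact: cdom_open.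
by exists x.
Qed.

Section Msmooth.
Context {M : manifold R} {V : normedModType R} (HV : comp_stable V).
Implicit Types (f g : M -> V) (x y : M).

(** Smoothness near x read in the chart at x; by [msmooth_chart] any chart
    around x would do. *)
Definition msmooth f x := smooth_near (f \o ci x) (cm x x).

Lemma smooth_chart_change f y z x : cdomn y x -> cdomn z x ->
  smooth_near (f \o ci y) (cm y x) -> smooth_near (f \o ci z) (cm z x).
Proof.
move=> yx zx fy.
apply: (smooth_near_eq (comp_in_charts (f := idfun) f _ zx yx)).
  exact: cvg_id.
apply: HV => /=; first exact: transition_smooth.
by rewrite cmapK.
Qed.

Lemma msmooth_chart f y x : cdomn y x ->
  msmooth f x <-> smooth_near (f \o ci y) (cm y x).
Proof. by move=> yx; split; apply: smooth_chart_change. Qed.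

(** The definition of [smooth_on] quantifies over all charts; compatibility of
    the charts reduces it to one chart at each point. *)
Lemma smooth_onP (U : set M) f : open U ->
  smooth_on U f <-> forall x, U x -> msmooth f x.
Proof.
move=> oU; split=> [h x Ux|h y].
  apply: (open_smooth_near _ _ (h x)); first exact: chart_img_open.
  by exists x.
apply/smooth_nearP; first exact: chart_img_open.
by move=> _ [x [yx Ux] <-]; apply/msmooth_chart => //; exact: h.
Qed.

Lemma msmooth_near f x : msmooth f x -> \forall y \near x, msmooth f y.
Proof.
move=> /smooth_near_near /(chart_near_pull (mem_chart x)).
by apply: filterS => y [xy /msmooth_chart]; exact.
Qed.

Lemma msmooth_open f x : msmooth f x ->
  exists U, [/\ open U, U x & smooth_on U f].
Proof.
move=> /msmooth_near h; exists [set y | msmooth f y]°; split => //.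
  exact: open_interior.
by apply/smooth_onP => [|y /nbhs_singleton//]; exact: open_interior.
Qed.

Lemma msmooth_near_eq f g x : (\forall y \near x, f y = g y) ->
  msmooth f x -> msmooth g x.
Proof.
by move=> /(chart_near_inv (mem_chart x)) fg; exact: smooth_near_eq.
Qed.

Lemma msmooth_cst (c : V) x : msmooth (cst c) x.
Proof. exact: smooth_near_cst. Qed.

Lemma msmooth_postcomp n (F : M -> 'rV[R]_n) (phi : 'rV[R]_n -> V) x :
  smooth_near (F \o ci x) (cm x x) -> smooth_near phi (F x) -> msmooth (phi \o F) x.
Proof. by move=> hF hphi; apply: (HV hF); rewrite /= cmapK. Qed.

End Msmooth.

Lemma msmooth_cmap (M : manifold R) (y x : M) : cdomn y x -> msmooth (cm y) x.
Proof. by move=> yx; apply: transition_smooth. Qed.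

Lemma msmooth_comp (M N : manifold R) (V : normedModType R) (f : M -> N) (g : N -> V) x :
  comp_stable V -> {for x, continuous f} -> msmooth (cm (f x) \o f) x ->
  msmooth g (f x) -> msmooth (g \o f) x.
Proof.
move=> HV fx hf hg.
apply: (smooth_near_eq (comp_in_charts g fx (mem_chart x) (mem_chart (f x)))).
by apply: HV => //=; rewrite cmapK.
Qed.

Lemma smooth_map_msmooth (M N : manifold R) (f : M -> N) x y :
  smooth_map f -> cdomn y (f x) -> msmooth (cm y \o f) x.
Proof.
move=> [fc h] yfx; have := h y; move/smooth_onP; apply => //.
- exact: comp_stable_mx.
- by move/continuousP: fc; apply; exact: cdom_open.
Qed.

Definition mjac (M : manifold R) m (f : M -> 'rV[R]_m) (x : M) :
  'M[R]_(mdim x, m) := jac (f \o ci x) (cm x x).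

Lemma mjac_comp_chart (M N : manifold R) m (f : M -> N) (g : N -> 'rV[R]_m)
    (z : M) (y : N) x : {for x, continuous f} -> cdomn z x -> cdomn y (f x) ->
  smooth_near (cm y \o f \o ci z) (cm z x) ->
  smooth_near (g \o ci y) (cm y (f x)) ->
  jac (g \o f \o ci z) (cm z x) =
  jac (cm y \o f \o ci z) (cm z x) *m jac (g \o ci y) (cm y (f x)).
Proof.
move=> fx zx yfx sf sg.
rewrite -(jac_near_eq (comp_in_charts g fx zx yfx)).
by rewrite jac_comp//= ?cmapK.
Qed.

Lemma grad_comp_chart (M N : manifold R) (f : M -> N) (g : N -> R)
    (z : M) (y : N) x : {for x, continuous f} -> cdomn z x -> cdomn y (f x) ->
  smooth_near (cm y \o f \o ci z) (cm z x) ->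
  smooth_near (g \o ci y) (cm y (f x)) ->
  grad (g \o f \o ci z) (cm z x) =
  jac (cm y \o f \o ci z) (cm z x) *m grad (g \o ci y) (cm y (f x)).
Proof.
move=> fx zx yfx sf sg.
rewrite -(grad_near_eq (comp_in_charts g fx zx yfx)).
by rewrite grad_comp//= ?cmapK.
Qed.

End ChartLemmas.

#[local] Hint Resolve mem_chart comp_stable_scalar comp_stable_mx : core.

Lemma nearI (T : topologicalType) (x : T) (P Q : T -> Prop) :
  (\forall y \near x, P y) -> (\forall y \near x, Q y) ->
  \forall y \near x, P y /\ Q y.
Proof. exact: filterI. Qed.

(** * Tangent maps as Jacobian matrices *)
Section IntrinsicJacobian.
Context {R : realType}.

Lemma mjac_chart (M : manifold R) m (f : M -> 'rV[R]_m) x y :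
  cdomn y x -> msmooth f x ->
  mjac f x = mjac (cm y) x *m jac (f \o ci y) (cm y x).
Proof.
move=> yx sf; apply: (mjac_comp_chart (f := idfun) (g := f)) => //.
- exact: transition_smooth.
- by move: sf; apply: (smooth_chart_change (@comp_stable_mx R 1 m)).
Qed.

Lemma dfun_chart (M : manifold R) (f : M -> R) x y :
  cdomn y x -> msmooth f x ->
  dfun f x = mjac (cm y) x *m grad (f \o ci y) (cm y x).
Proof.
move=> yx sf; apply: (grad_comp_chart (f := idfun) (g := f)) => //.
- exact: transition_smooth.
- by move: sf; apply: (smooth_chart_change (@comp_stable_scalar R)).
Qed.

Lemma near_chart (T : topologicalType) (M : manifold R) (f : T -> M) x y :
  {for x, continuous f} -> cdomn y (f x) -> \forall z \near x, cdomn y (f z).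
Proof.
move=> fx yfx; apply: (near_continuous fx).
exact: (open_near (@cdom_open _ _ (mchart y))).
Qed.

Lemma mjac_cmap_self (M : manifold R) (x : M) : mjac (cm x) x = 1%:M.
Proof.
rewrite /mjac (jac_near_eq (g := fun v => v)); first by have [] := smooth_near_id (cm x x).
by apply: filterS (chart_near (mem_chart x)) => u [].
Qed.

Lemma mjac_cmapK (M : manifold R) (y x : M) : cdomn y x ->
  exists C, mjac (cm y) x *m C = 1%:M /\ C *m mjac (cm y) x = 1%:M.
Proof.
move=> yx; exists (jac (cm x \o ci y) (cm y x)); split.
  by rewrite -mjac_chart ?mjac_cmap_self//; exact: msmooth_cmap.
rewrite -[RHS](_ : jac (cm y \o ci y) (cm y x) = _); last first.
  rewrite (jac_near_eq (g := fun v => v)); first by have [] := smooth_near_id (cm y x).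
  by apply: filterS (chart_near yx) => u [].
symmetry; apply: (mjac_comp_chart (f := idfun) (g := cm y)) => //.
- exact: transition_smooth.
- exact: msmooth_cmap.
Qed.

Lemma mjac_comp (M N : manifold R) m (f : M -> N) (g : N -> 'rV[R]_m) x y :
  {for x, continuous f} -> cdomn y (f x) -> msmooth (cm y \o f) x -> msmooth g (f x) ->
  mjac (g \o f) x = mjac (cm y \o f) x *m jac (g \o ci y) (cm y (f x)).
Proof.
move=> fx yfx sf sg; apply: mjac_comp_chart => //.
by move: sg; apply: (smooth_chart_change (@comp_stable_mx R 1 m)).
Qed.

Lemma dfun_comp (M N : manifold R) (f : M -> N) (g : N -> R) x y :
  {for x, continuous f} -> cdomn y (f x) -> msmooth (cm y \o f) x -> msmooth g (f x) ->
  dfun (g \o f) x = mjac (cm y \o f) x *m grad (g \o ci y) (cm y (f x)).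
Proof.
move=> fx yfx sf sg; apply: grad_comp_chart => //.
by move: sg; apply: (smooth_chart_change (@comp_stable_scalar R)).
Qed.

Lemma tangent_mapE (M N : manifold R) (f : M -> N) x v : smooth_map f ->
  tangent_map f x v = v *m mjac (cm (f x) \o f) x.
Proof.
move=> sf; rewrite /tangent_map lfunE /= smooth_near_diffE//.
exact: smooth_map_msmooth.
Qed.

Lemma tangent_coordE (M : manifold R) (y x : M) v : cdomn y x ->
  tangent_coord y v = v *m mjac (cm y) x.
Proof. by move=> yx; rewrite /tangent_coord smooth_near_diffE//; exact: transition_smooth. Qed.

Lemma smooth_map_continuous (M N : manifold R) (f : M -> N) x :
  smooth_map f -> {for x, continuous f}.
Proof. by case=> + _; apply. Qed.

Lemma dfun_smooth_map (M N : manifold R) (f : M -> N) (g : N -> R) x :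
  smooth_map f -> msmooth g (f x) ->
  dfun (g \o f) x = mjac (cm (f x) \o f) x *m dfun g (f x).
Proof.
move=> sf sg; apply: dfun_comp => //; first exact: smooth_map_continuous.
exact: smooth_map_msmooth.
Qed.

Lemma mjac_smooth_map (M N : manifold R) m (f : M -> N) (g : N -> 'rV[R]_m) x :
  smooth_map f -> msmooth g (f x) ->
  mjac (g \o f) x = mjac (cm (f x) \o f) x *m mjac g (f x).
Proof.
move=> sf sg; apply: mjac_comp => //; first exact: smooth_map_continuous.
exact: smooth_map_msmooth.
Qed.

Lemma smooth_map_comp_msmooth (M N : manifold R) (V : normedModType R) (f : M -> N)
    (g : N -> V) x : comp_stable V ->
  smooth_map f -> msmooth g (f x) -> msmooth (g \o f) x.
Proof.
move=> HV sf sg; apply: msmooth_comp => //; first exact: smooth_map_continuous.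
exact: smooth_map_msmooth.
Qed.

End IntrinsicJacobian.

(** * Frames of the subbundle and adapted extensions *)
Lemma basis_matrix (F : fieldType) n d (U : {vspace 'rV[F]_n}) (X : 'I_d -> 'rV[F]_n) :
  basis_of U [seq X k | k <- enum 'I_d] ->
  row_free (\matrix_k X k) /\
  forall x, x \in U <-> exists c, x = c *m \matrix_k X k.
Proof.
set T := [tuple X k | k < d].
have -> : [seq X k | k <- enum 'I_d] = T by [].
have TE (k : 'I_d) : T`_k = X k by rewrite -tnth_nth tnth_mktuple.
have mulE (c : 'rV_d) : c *m \matrix_k X k = \sum_k c 0 k *: T`_k.
  by rewrite mulmx_sum_row; apply: eq_bigr => k _; rewrite rowK TE.
move=> /andP[/eqP <- fT]; split.
  rewrite -kermx_eq0; apply/rowV0P => c /sub_kermxP.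
  rewrite mulE => c0; move/freeP: fT => /(_ _ c0) h.
  by apply/rowP => k; rewrite mxE h.
move=> x; split=> [/coord_span ->|[c ->]].
  by exists (\row_k coord T k x); rewrite mulE; apply: eq_bigr => k _; rewrite mxE.
rewrite mulE; apply: memv_suml => k _; apply: memvZ; apply: memv_span.
by apply: mem_nth; rewrite size_tuple.
Qed.

Section LocalFrame.
Context {R : realType} {P S : manifold R} (i : S -> P).
Hypothesis i_emb : embedding i.
Variable D : forall s : S, {vspace tangent R (i s)}.
Hypothesis D_sub : subbundle_along D.

Let i_smooth : smooth_map i. Proof. by case: i_emb => -[]. Qed.
Let i_cont s : {for s, continuous i}. Proof. exact: smooth_map_continuous. Qed.

Lemma embedding_nbhs m (A : set S) : nbhs m A ->
  exists U : set P, [/\ open U, U (i m) & forall s, U (i s) -> A s].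
Proof.
case: i_emb => _ _ rel mA; have [U oU UE] := rel A° (open_interior _).
have U_ s : A° s <-> U (i s) by rewrite UE.
exists U; split => //; first by apply/U_.
by move=> s /U_ /nbhs_singleton.
Qed.

Lemma embedding_left_inverse m : exists A, mjac (cm (i m) \o i) m *m A = 1%:M.
Proof.
exists (pinvmx (mjac (cm (i m) \o i) m)); apply: mulmxVp.
rewrite -kermx_eq0; apply/rowV0P => v /sub_kermxP vK.
case: i_emb => -[_ ker0] _ _; apply/eqP; rewrite -memv0 -(ker0 m) memv_ker.
by rewrite tangent_mapE// vK.
Qed.

Lemma mem_DS s v : (v \in DS D s) = (tangent_map i s v \in D s).
Proof. by rewrite /DS -memv_preim. Qed.

Variable m : S.

Definition coord_incl : 'rV[R]_(mdim m) -> 'rV[R]_(mdim (i m)) :=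
  cm (i m) \o i \o ci m.

Lemma coord_incl_smooth : smooth_near coord_incl (cm m m).
Proof. exact: smooth_map_msmooth. Qed.

Lemma coord_incl_chart s : cdomn m s -> coord_incl (cm m s) = cm (i m) (i s).
Proof. by move=> ms; rewrite /coord_incl /= cmapK. Qed.

Lemma tangent_map_coord s v : cdomn m s -> cdomn (i m) (i s) ->
  tangent_map i s v *m mjac (cm (i m)) (i s) =
  v *m mjac (cm m) s *m jac coord_incl (cm m s).
Proof.
move=> ms pis; rewrite tangent_mapE// -!mulmxA; congr (_ *m _).
rewrite -mjac_smooth_map//; last exact: msmooth_cmap.
by apply: mjac_chart => //; exact: smooth_map_msmooth.
Qed.

(** Coordinate form near m of a frame of D: the rows of X(u) span the image of
    D in the chart at i m. *)
Record local_frame (d : nat) (X : 'rV[R]_(mdim m) -> 'M[R]_(d, mdim (i m))) : Prop := {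
  frame_smooth : smooth_near X (cm m m);
  frame_free : row_free (X (cm m m));
  frame_mem : \forall s \near m, [/\ cdomn m s, cdomn (i m) (i s) &
    forall x, x \in D s <-> exists c, x *m mjac (cm (i m)) (i s) = c *m X (cm m s)] }.

Lemma local_frame_exists : exists d X, @local_frame d X.
Proof.
have [W [d [X [oW Wm sX bX]]]] := D_sub m.
exists d, (fun u => \matrix_k tangent_coord (i m) (X k (ci m u))).
have XE s : cdomn m s -> cdomn (i m) (i s) ->
    \matrix_k tangent_coord (i m) (X k (ci m (cm m s))) =
    (\matrix_k X k s) *m mjac (cm (i m)) (i s).
  move=> ms pis; rewrite cmapK//; apply/row_matrixP => k.
  by rewrite row_mul !rowK tangent_coordE.
have near_dom : \forall s \near m, cdomn m s /\ cdomn (i m) (i s).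
  apply: filterI; first exact: (open_near (@cdom_open _ _ _)).
  exact: near_chart (@i_cont m) (mem_chart (i m)).
split.
- apply/smooth_near_mxP => k j; under eq_fun do rewrite mxE.
  have oW' : open (W `&` i @^-1` cdomn (i m)).
    apply: openI => //; case: i_smooth => /continuousP + _; apply; exact: cdom_open.
  have Wm' : (W `&` i @^-1` cdomn (i m)) m by split=> //; exact: mem_chart.
  have /smooth_near_mxP h : msmooth (fun s => tangent_coord (i m) (X k s)) m.
    by move: (sX k (i m)) => /(smooth_onP (@comp_stable_mx _ _ _) _ oW'); exact.
  exact: h.
- rewrite XE// mjac_cmap_self mulmx1.
  by have [] := basis_matrix (bX m Wm).
- apply: filterS2 near_dom (open_near oW Wm) => s [ms pis] Ws; split=> // x.
  have [_ bD] := basis_matrix (bX s Ws).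
  have [C [CK _]] := mjac_cmapK pis.
  rewrite XE//; split=> [/bD[c ->]|[c xc]]; first by exists c; rewrite mulmxA.
  apply/bD; exists c; have := congr1 (mulmx^~ C) xc.
  by rewrite -!mulmxA CK !mulmx1.
Qed.

Hypothesis DS_smooth : smooth_distribution (DS D).

Lemma DS_frame_mem d X : @local_frame d X -> \forall s \near m,
  forall v, v \in DS D s <->
    exists c, v *m mjac (cm m) s *m jac coord_incl (cm m s) = c *m X (cm m s).
Proof.
move=> fX; apply: filterS (frame_mem fX) => s [ms pis DE] v.
by rewrite mem_DS DE tangent_map_coord.
Qed.

(** Its left kernel is D_S: a vanishing combination of the rows is a vector of
    TS together with its expression in the frame of D. *)
Definition frame_matrix d (X : 'rV[R]_(mdim m) -> 'M[R]_(d, mdim (i m))) u :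
  'M[R]_(mdim m + d, mdim (i m)) := col_mx (jac coord_incl u) (X u).

Lemma frame_matrix_smooth d X : @local_frame d X ->
  smooth_near (frame_matrix X) (cm m m).
Proof.
move=> fX; apply/smooth_near_mxP => k j; rewrite /frame_matrix.
case: (split_ordP k) => l ->.
  under eq_fun do rewrite col_mxEu.
  by have /smooth_near_jac/smooth_near_mxP := coord_incl_smooth; apply.
under eq_fun do rewrite col_mxEd.
by have /smooth_near_mxP := frame_smooth fX; apply.
Qed.

(** Smooth fields Y that span D_S at m stay independent nearby. Completed by
    their coordinates in the frame of D, they are elements of the left kernel,
    whose dimension can thus not drop near m; and at m this dimension is exactly
    the number of the fields, as the frame is free there. *)
Lemma frame_rank_near d X : @local_frame d X ->
  \forall u \near cm m m, (\rank (frame_matrix X u) <= \rank (frame_matrix X (cm m m)))%N.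
Proof.
move=> fX; pose k := \dim (DS D m).
have fieldY (l : 'I_k) : exists WY : set S * (forall s, tangent R s),
    [/\ open WY.1, WY.1 m, @smooth_field_along R S S id WY.1 WY.2,
        forall s, WY.1 s -> WY.2 s \in DS D s & WY.2 m = (vbasis (DS D m))`_l].
  have vl : (vbasis (DS D m))`_l \in DS D m.
    by apply: vbasis_mem; apply: mem_nth; rewrite size_tuple.
  by have [W [Y [? ? ? ? ?]]] := DS_smooth vl; exists (W, Y).
have [WY WYP] := choice fieldY.
pose Y u : 'M[R]_(k, mdim m) := \matrix_l tangent_coord m ((WY l).2 (ci m u)).
have Y0 : Y (cm m m) = \matrix_l (vbasis (DS D m))`_l.
  rewrite /Y cmapK//; apply/row_matrixP => l; rewrite !rowK tangent_coordE//.
  by rewrite mjac_cmap_self mulmx1; have [] := WYP l.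
have [Y0_free Y0_mem] : row_free (Y (cm m m)) /\
    forall x, x \in DS D m <-> exists c, x = c *m Y (cm m m).
  rewrite Y0; apply: basis_matrix.
  have -> : [seq (vbasis (DS D m))`_(l : 'I_k) | l <- enum 'I_k] = vbasis (DS D m).
    rewrite -[LHS]/(tval [tuple (vbasis (DS D m))`_l | l < k]); congr tval.
    by apply: eq_from_tnth => l; rewrite tnth_mktuple (tnth_nth 0).
  exact: vbasisP.
have sY : smooth_near Y (cm m m).
  apply/smooth_near_mxP => l j; under eq_fun do rewrite mxE.
  have [oW Wm sYl _ _] := WYP l.
  have oW' : open ((WY l).1 `&` id @^-1` cdomn m).
    by apply: openI => //; exact: cdom_open.
  have Wm' : ((WY l).1 `&` id @^-1` cdomn m) m by split=> //; exact: mem_chart.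
  have /smooth_near_mxP h : msmooth (fun s => tangent_coord m ((WY l).2 s)) m.
    by move: (sYl m) => /(smooth_onP (@comp_stable_mx _ _ _) _ oW'); exact.
  exact: h.
have kerY : \forall u \near cm m m,
    exists c, Y u *m jac coord_incl u = c *m X u.
  have memY : \forall s \near m, forall l : 'I_k, (WY l).2 s \in DS D s.
    apply: near_forall => l; have [oW Wm _ h _] := WYP l.
    by apply: filterS (open_near oW Wm) => s; exact: h.
  have dom : \forall s \near m, cdomn m s.
    exact: (open_near (@cdom_open _ _ (mchart m))).
  have := chart_near_inv (mem_chart m) (nearI dom (nearI memY (DS_frame_mem fX))).
  apply: filterS2 (chart_near (mem_chart m)) => u [_ uE] [ms [mY mE]].
  have h l : exists c : 'rV_d, row l (Y u) *m jac coord_incl u = c *m X u.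
    have /mE := mY l; rewrite uE => -[c cE]; exists c.
    by rewrite rowK tangent_coordE.
  have [c cE] := choice h; exists (\matrix_l c l).
  by apply/row_matrixP => l; rewrite !row_mul rowK.
have rkker : (\rank (kermx (frame_matrix X (cm m m))) <= k)%N.
  set K := kermx _; pose L := lsubmx K; pose N := rsubmx K.
  have LN : L *m jac coord_incl (cm m m) + N *m X (cm m m) = 0.
    by rewrite -mul_row_col hsubmxK mulmx_ker.
  have NE : N = L *m (- (jac coord_incl (cm m m) *m pinvmx (X (cm m m)))).
    move/eqP: LN; rewrite addr_eq0 -mulNmx => /eqP LN.
    have := congr1 (mulmx^~ (pinvmx (X (cm m m)))) LN.
    rewrite -!mulmxA mulmxVp ?(frame_free fX)// mulmx1 => LN'.
    by rewrite mulmxN -[RHS]/(- _) LN' opprK.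
  have KE : K = L *m row_mx 1%:M (- (jac coord_incl (cm m m) *m pinvmx (X (cm m m)))).
    by rewrite mul_mx_row mulmx1 -NE hsubmxK.
  have LY : (L <= Y (cm m m))%MS.
    apply/row_subP => l; apply/submxP.
    have /Y0_mem[c cE] : row l L \in DS D m.
      apply/(nbhs_singleton (DS_frame_mem fX)); exists (- row l N).
      rewrite mjac_cmap_self mulmx1; apply/eqP.
      move: (congr1 (row l) LN); rewrite raddfD /= !row_mul row0 => h.
      by rewrite mulNmx -addr_eq0 h.
    by exists c.
  rewrite KE; apply: leq_trans (mxrankM_maxl _ _) _.
  by apply: leq_trans (mxrankS LY) _; exact: rank_leq_row.
have := rank_lower_semicontinuous sY.
apply: filterS2 kerY => u [c cE]; rewrite (eqP Y0_free) => rkY.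
have : row_mx (Y u) (- c) *m frame_matrix X u = 0.
  by rewrite mul_row_col cE mulNmx subrr.
move=> /mulmx0_rank_max h.
have : (k <= \rank (row_mx (Y u) (- c)))%N.
  apply: leq_trans rkY _.
  have YE : Y u = row_mx (Y u) (- c) *m col_mx 1%:M 0.
    by rewrite mul_row_col mulmx1 mulmx0 addr0.
  by rewrite {1}YE; exact: mxrankM_maxl.
move: rkker; rewrite mxrank_ker => h1 h2.
have := rank_leq_row (frame_matrix X (cm m m)).
by move: h1 h2 h; lia.
Qed.

(** A function on S with differential zero on D_S extends to P with a
    differential that kills D all along S and that is prescribed at m. The
    covector field is the solution w of M(u) w = (dh, 0); the system is
    compatible because the left kernel of M is D_S. *)
Lemma adapted_extension (W : set S) (h : S -> R) (a : cotangent R (i m)) :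
  nbhs m W -> msmooth h m ->
  (\forall s \near m, forall v, v \in DS D s -> pairing (dfun h s) v = 0) ->
  exists U F, [/\ open U, U (i m), smooth_on U F,
    forall s, U (i s) -> [/\ W s, F (i s) = h s & annihilates D (dfun F (i s))] &
    annihilates D a ->
    (forall v, pairing a (tangent_map i m v) = pairing (dfun h m) v) ->
    dfun F (i m) = a].
Proof.
move=> mW sh dh; have [d [X fX]] := local_frame_exists.
pose b u : 'cV[R]_(mdim m + d) := col_mx (grad (h \o ci m) u) 0.
have sb : smooth_near b (cm m m).
  apply/smooth_near_mxP => k j; rewrite /b; case: (split_ordP k) => l ->.
    under eq_fun do rewrite col_mxEu.
    by have /smooth_near_grad/smooth_near_mxP := sh; apply.
  by under eq_fun do rewrite col_mxEd mxE; exact: smooth_near_cst.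
have dom : \forall s \near m, cdomn m s.
  exact: (open_near (@cdom_open _ _ (mchart m))).
have kerb : \forall u \near cm m m,
    forall z : 'rV_(mdim m + d), z *m frame_matrix X u = 0 -> z *m b u = 0.
  have := chart_near_inv (mem_chart m)
    (nearI dom (nearI (msmooth_near (@comp_stable_scalar R) sh)
       (nearI dh (DS_frame_mem fX)))).
  apply: filterS2 (chart_near (mem_chart m)) => u [_ uE] [ms [shs [dhs mE]]] z.
  rewrite uE in mE; rewrite -[z]hsubmxK /frame_matrix /b !mul_row_col mulmx0 addr0.
  set w := lsubmx z; set c := rsubmx z => /eqP; rewrite addr_eq0 -mulNmx => /eqP wE.
  have [C [_ CK]] := mjac_cmapK ms.
  have /dhs : w *m C \in DS D (ci m u).
    by apply/mE; exists (- c); rewrite -[w *m C *m _]mulmxA CK mulmx1.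
  rewrite /pairing (dfun_chart ms shs) uE mulmxA -[w *m C *m _]mulmxA CK mulmx1 => h0.
  by apply/matrixP => x y; rewrite !ord1 h0 mxE.
have [w [sw Mw w0]] := smooth_linear_solution a (frame_matrix_smooth fX) sb
  (frame_rank_near fX) kerb.
have Mw1 : \forall u \near cm m m, jac coord_incl u *m w u = grad (h \o ci m) u.
  by apply: filterS Mw => u; rewrite mul_col_mx => /eq_col_mx[].
have Mw2 : \forall u \near cm m m, X u *m w u = 0.
  by apply: filterS Mw => u; rewrite mul_col_mx => /eq_col_mx[].
have [A jA] := embedding_left_inverse m.
have [r [sr rK]] := immersion_retraction coord_incl_smooth jA.
have [F [sF FE]] := prescribed_extension coord_incl_smooth sr rK sh sw Mw1.
rewrite coord_incl_chart// in sF.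
have sFP : msmooth (F \o cm (i m)) (i m).
  by apply: (msmooth_postcomp (@comp_stable_scalar R)) => //; exact: msmooth_cmap.
have [U1 [oU1 U1m sFU]] := msmooth_open (@comp_stable_scalar R) sFP.
have good : \forall s \near m, [/\ W s, F (cm (i m) (i s)) = h s,
    smooth_near F (cm (i m) (i s)) ->
    dfun (F \o cm (i m)) (i s) = mjac (cm (i m)) (i s) *m w (cm m s) &
    smooth_near F (cm (i m) (i s)) ->
    annihilates D (dfun (F \o cm (i m)) (i s))].
  have := nearI (chart_near_pull (mem_chart m) (nearI FE Mw2)) (nearI mW (frame_mem fX)).
  apply: filterS => s [[ms [[Fh Fw] Xw]] [Ws [_ pis DE]]].
  rewrite coord_incl_chart// in Fh Fw.
  have dF : smooth_near F (cm (i m) (i s)) ->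
      dfun (F \o cm (i m)) (i s) = mjac (cm (i m)) (i s) *m w (cm m s).
    move=> sFs; rewrite (dfun_chart pis).
      congr (_ *m _); rewrite -Fw; apply: grad_near_eq.
      by apply: filterS (chart_near pis) => u [_ uE] /=; rewrite uE.
    by apply: (msmooth_postcomp (@comp_stable_scalar R)) => //; exact: msmooth_cmap.
  split=> //; first by rewrite Fh /= cmapK.
  move=> sFs v /DE[c cE].
  by rewrite /pairing dF// mulmxA cE -mulmxA Xw mulmx0 mxE.
have [U2 [oU2 U2m U2good]] := embedding_nbhs good.
have sFnear : \forall x \near i m, cdomn (i m) x /\ smooth_near F (cm (i m) x).
  exact: (chart_near_pull (mem_chart (i m)) (smooth_near_near sF)).
pose U3 := [set x | cdomn (i m) x /\ smooth_near F (cm (i m) x)]°.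
have sF3 x : U3 x -> smooth_near F (cm (i m) x) by move=> /nbhs_singleton[].
exists (U1 `&` (U2 `&` U3)), (F \o cm (i m)); split.
- by apply: openI => //; apply: openI => //; exact: open_interior.
- by [].
- apply/(smooth_onP (@comp_stable_scalar R)).
    by apply: openI => //; apply: openI => //; exact: open_interior.
  move=> x [U1x _]; move: sFU => /(smooth_onP (@comp_stable_scalar R) _ oU1); exact.
- move=> s [_ [U2s /sF3 sFs]]; have [Ws Fh _ /(_ sFs) aF] := U2good s U2s.
  by split.
- move=> aD ha; have [_ _ /(_ sF) -> _] := nbhs_singleton good.
  rewrite mjac_cmap_self mul1mx; apply: w0.
  rewrite mul_col_mx; congr col_mx.
    apply/row_matrixP => l; rewrite !rowE; apply/matrixP => x y; rewrite !ord1.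
    have := ha (delta_mx 0 l); rewrite /pairing tangent_mapE// -mulmxA.
    by [].
  apply/row_matrixP => l; rewrite row_mul row0; apply/matrixP => x y; rewrite !ord1 [RHS]mxE.
  have [_ _ /(_ (row l (X (cm m m))))[_ h1]] := nbhs_singleton (frame_mem fX).
  apply: (aD (row l (X (cm m m)))); apply: h1; exists (delta_mx 0 l).
  by rewrite mjac_cmap_self mulmx1 rowE.
Qed.

End LocalFrame.

(** * Submersions and leaves *)
Section Submersions.
Context {R : realType} {M N : manifold R} (f : M -> N).
Hypothesis f_sub : submersion f.

Lemma submersion_right_inverse x : exists A, A *m mjac (cm (f x) \o f) x = 1%:M.
Proof.
case: f_sub => sf full; exists (pinvmx (mjac (cm (f x) \o f) x)).
apply: mulVpmx; rewrite -sub1mx; apply/row_subP => l; apply/submxP.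
have : row l 1%:M \in limg (tangent_map f x) by rewrite full memvf.
by move=> /memv_imgP[v _ ->]; exists v; rewrite tangent_mapE.
Qed.

(** A submersion has local smooth sections. *)
Lemma submersion_descends (V : normedModType R) (g : N -> V) x :
  comp_stable V -> msmooth (g \o f) x -> msmooth g (f x).
Proof.
move=> HV sgf; have [A AD] := submersion_right_inverse x.
have sf : smooth_map f by case: f_sub.
set p := cm (f x) \o f \o ci x.
have sp : smooth_near p (cm x x) by exact: smooth_map_msmooth.
have [Phi [Psi [[_ sPsi] _ [_ Psi0] _ pPsi]]] := submersion_straighten sp AD.
have p0 : p (cm x x) = cm (f x) (f x) by rewrite /p /= cmapK.
set w0 := cm (f x) (f x) in p0 *.
pose aff (w : 'rV[R]_(mdim (f x))) := w *m A + cst (cm x x - w0 *m A) w.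
have aff0 : aff w0 = cm x x by rewrite /aff /cst addrC subrK.
have saff : smooth_near aff w0.
  have [s1 _] := smooth_near_id w0.
  have [s2 _] := smooth_near_mulmxr A s1.
  exact: (smooth_nearD_rV s2 (smooth_near_cst (cm x x - w0 *m A) w0)).1.
pose sec := Psi \o aff.
have ssec : smooth_near sec w0 by apply: smooth_near_comp => //; rewrite aff0.
have sec0 : sec w0 = cm x x by rewrite /sec /= aff0.
have fcx : {for x, continuous f} by exact: smooth_map_continuous.
have secE : \forall w \near w0, f (ci x (sec w)) = ci (f x) w.
  have h1 : \forall w \near w0, p (sec w) = w.
    have := near_continuous (smooth_near_continuous saff)
      (U := fun y => p (Psi y) = p (cm x x) + (y - cm x x) *m jac p (cm x x)).
    rewrite aff0 => /(_ pPsi); apply: filterS => w /= ->.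
    have -> : aff w - cm x x = (w - w0) *m A.
      by apply/rowP => j; rewrite mulmxBl /aff /cst !mxE; ring.
    by rewrite p0 -mulmxA AD mulmx1 addrC subrK.
  have h2 : \forall w \near w0, cdomn (f x) (f (ci x (sec w))).
    have dom : \forall y \near x, cdomn (f x) (f y) by exact: near_chart.
    have := near_continuous (smooth_near_continuous ssec) (U := fun u => cdomn (f x) (f (ci x u))).
    by rewrite sec0; apply; exact: chart_near_inv dom.
  by apply: filterS2 h1 h2 => w e d; rewrite -[in RHS]e /p /= cmapK.
apply: (smooth_near_eq (f := (g \o f \o ci x) \o sec)).
  by apply: filterS secE => w /= ->.
by apply: HV => //; rewrite sec0.
Qed.

End Submersions.

Section Leaves.
Context {R : realType} {S : manifold R}.
Variable E : forall s : S, {vspace tangent R s}.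
Hypothesis E_max : forall s : S, exists2 L, maximal_integral_manifold E L & L s.

Lemma leaf_projP s s' : leaf_proj E s = leaf_proj E s' <-> leaf E s = leaf E s'.
Proof.
split=> [/eqmodP/asboolP//|h]; rewrite /leaf_proj.
by apply/eqmodP/asboolP.
Qed.

Lemma leaf_maximal s L : maximal_integral_manifold E L -> L s -> leaf E s = L.
Proof.
move=> maxL Ls; apply/seteqP; split=> [s' [L' [maxL' L's L's']]|s' Ls']; last by exists L.
case: maxL => _ /(_ L' maxL'.1); apply => //; by exists s.
Qed.

Lemma leaf_proj_integral L s s' : integral_manifold E L -> L s -> L s' ->
  leaf_proj E s = leaf_proj E s'.
Proof.
move=> iL Ls Ls'; apply/leaf_projP; have [L0 maxL0 L0s] := E_max s.
have LL0 : L `<=` L0 by case: maxL0 => _; apply => //; exists s.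
by rewrite !(leaf_maximal maxL0)//; exact: LL0.
Qed.

(** The fibres of the projection are single integral manifolds, because a maximal
    one contains all those that it meets. *)
Lemma leaf_proj_fibre s : exists L, [/\ integral_manifold E L, L s &
  forall s', leaf_proj E s = leaf_proj E s' <-> L s'].
Proof.
have [L maxL Ls] := E_max s; exists L; split; [exact: maxL.1|by []|].
move=> s'; split=> [/leaf_projP|Ls']; last exact: leaf_proj_integral maxL.1 Ls Ls'.
rewrite (leaf_maximal maxL Ls) => ->; have [L' maxL' L's'] := E_max s'.
by rewrite (leaf_maximal maxL' L's').
Qed.

End Leaves.

Lemma interval_uncountable (R : realType) (e : R) : 0 < e ->
  ~ countable [set t : R | - e < t < e].
Proof.
move=> e0 /countable_lebesgue_measure0.
have -> : [set t : R | - e < t < e] = `]- e, e[%classic.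
  by apply/seteqP; split=> t; rewrite /= in_itv.
rewrite lebesgue_measure_itv /= lte_fin; case: ltP => [_|].
  by rewrite -EFinD => -[] /eqP; rewrite opprK gt_eqF// addr_gt0.
by rewrite leNgt gtrN.
Qed.

(** * The kernel of the projection *)
Lemma row_free_col_mx_rV (F : fieldType) n d (x : 'rV[F]_n) (X : 'M[F]_(d, n)) :
  row_free X -> (forall c, x <> c *m X) -> row_free (col_mx x X).
Proof.
move=> fX nx; rewrite -kermx_eq0; apply/rowV0P => z /sub_kermxP.
rewrite -[z]hsubmxK mul_row_col; set a := lsubmx z; set c := rsubmx z.
rewrite [a]mx11_scalar mul_scalar_mx.
have [->|a0] := eqVneq (a 0 0) 0.
  rewrite scale0r add0r => /eqP; rewrite mulmx_free_eq0// => /eqP ->.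
  by rewrite -scalemx1 scale0r row_mx0.
move=> /eqP; rewrite addr_eq0 => /eqP e; exfalso.
apply: (nx (- ((a 0 0)^-1 *: c))); rewrite mulNmx -scalemxAl -scalerN -e.
by rewrite scalerA mulVf// scale1r.
Qed.

Lemma row_free_col_mx_notin (F : fieldType) n d (x : 'rV[F]_n) (X : 'M[F]_(d, n)) c :
  row_free (col_mx x X) -> x <> c *m X.
Proof.
move=> fX xc; have : row_mx 1%:M (- c) *m col_mx x X = 0.
  by rewrite mul_row_col mul1mx mulNmx -xc subrr.
move=> /eqP; rewrite mulmx_free_eq0// => /eqP /(congr1 lsubmx).
rewrite row_mxKl => /matrixP/(_ 0 0); rewrite !mxE /= => /eqP.
by rewrite mulr1n oner_eq0.
Qed.

Section Kernel.
Context {R : realType} {P S : manifold R} (i : S -> P).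
Hypothesis i_emb : embedding i.
Variable D : forall s : S, {vspace tangent R (i s)}.
Hypothesis D_sub : subbundle_along D.
Hypothesis DS_max :
  forall s : S, exists2 L, maximal_integral_manifold (DS D) L & L s.
Variable A : smooth_structure R (leaf_space (DS D)).
Let Q : manifold R := Manifold A.
Let pi : S -> Q := leaf_proj (DS D).
Hypothesis pi_sub : submersion pi.

Let pi_smooth : smooth_map pi. Proof. by case: pi_sub. Qed.

(** The projection is constant on integral manifolds, whose tangent spaces are
    those of the distribution. *)
Lemma DS_sub_kernel s v :
  v \in DS D s -> v *m mjac (cm (pi s) \o pi) s = 0.
Proof.
have [L [iL Ls _]] := leaf_proj_fibre DS_max s.
have [N [j [_ [sj _] _ rj Tj]]] := iL.
have : range j s by rewrite rj.
case=> x _ xs; subst s; rewrite -Tj => /memv_imgP[w _ ->].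
rewrite tangent_mapE// -mulmxA -mjac_smooth_map//; last exact: smooth_map_msmooth.
rewrite /mjac (jac_near_eq (g := cst (cm (pi (j x)) (pi (j x))))) ?jac_cst ?mulmx0//.
near=> u; rewrite /cst /=; congr (cm _ _).
by apply: (leaf_proj_integral DS_max iL); rewrite -rj; [exists (ci x u)|exists x].
Unshelve. all: by end_near. Qed.

(** The fibre of pi through m contains the curve g t = Psi (y t), straight in the
    coordinates Phi and with velocity v. Close to m it is transverse to D_S, by
    the openness of linear independence. The fibre is the image of an integral
    manifold N, and the points x t of N over the curve are isolated: if the
    linear map Lam kills v and inverts the derivative of Phi o j, then Lam o Phi
    is constant on the curve, and Lam o Phi o j injective close to x t. Being second countable, N has
    only countably many such points, whereas t ranges over an interval. *)
Lemma kernel_sub_DS m v :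
  v *m mjac (cm (pi m) \o pi) m = 0 -> v \in DS D m.
Proof.
move=> vK; apply: contrapT => /negP vD.
have [A0 AD] := submersion_right_inverse pi_sub m.
set p := cm (pi m) \o pi \o ci m.
have sp : smooth_near p (cm m m) by exact: smooth_map_msmooth.
have [Phi [Psi [[sPhi sPsi] jPhi [Phi0 Psi0] [PsiK PhiK] pPsi]]] :=
  submersion_straighten sp AD.
have [d [X fX]] := local_frame_exists i_emb D_sub m.
have v0 : v != 0 by apply: contraNneq vD => ->; exact: mem0v.
pose B u := col_mx (v *m invmx (jac Phi u) *m jac (@coord_incl _ _ _ i m) u) (X u).
have uPhi : jac Phi (cm m m) \in unitmx by rewrite jPhi unitmx1.
have sB : smooth_near B (cm m m).
  apply/smooth_near_mxP => k l; rewrite /B; case: (split_ordP k) => r ->.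
    under eq_fun do rewrite col_mxEu.
    have : smooth_near
        (fun u => v *m invmx (jac Phi u) *m jac (@coord_incl _ _ _ i m) u) (cm m m).
      apply: smooth_near_mulmx; last exact/smooth_near_jac/coord_incl_smooth.
      apply: smooth_near_mulmx; first exact: smooth_near_cst.
      by apply: smooth_near_invmx => //; exact: smooth_near_jac.
    by move/smooth_near_mxP; apply.
  under eq_fun do rewrite col_mxEd.
  by have /smooth_near_mxP := frame_smooth fX; apply.
have B0 : row_free (B (cm m m)).
  apply: row_free_col_mx_rV; first exact: frame_free fX.
  move=> c vc; move/negP: vD; apply.
  have /(_ v)[_] := nbhs_singleton (DS_frame_mem i_emb fX); apply; exists c.
  by rewrite -vc jPhi invmx1 mulmx1 mjac_cmap_self mulmx1.
have B_near : \forall u \near cm m m, row_free (B u).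
  have := rank_lower_semicontinuous sB; apply: filterS => u.
  by rewrite (eqP B0) /row_free eqn_leq rank_leq_row.
(* the conditions that hold near m and are used all along the curve *)
pose good u := [/\ cdomn m (ci m u) /\ cm m (ci m u) = u,
  smooth_near Phi u /\ jac Phi u \in unitmx, row_free (B u),
  forall w, w \in DS D (ci m u) -> exists c,
    w *m mjac (cm m) (ci m u) *m jac (@coord_incl _ _ _ i m) u = c *m X u &
  cdomn (pi m) (pi (ci m u))].
have good_near : \forall u \near cm m m, good u.
  have n1 : \forall u \near cm m m, cdomn m (ci m u) /\ cm m (ci m u) = u.
    exact: chart_near.
  have n2 : \forall u \near cm m m, jac Phi u \in unitmx.
    by apply: (unitmx_near (smooth_near_jac sPhi)).
  have n3 := chart_near_inv (mem_chart m) (DS_frame_mem i_emb fX).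
  have n4 : \forall s \near m, cdomn (pi m) (pi s).
    by apply: near_chart => //; exact: smooth_map_continuous.
  have n5 := chart_near_inv (mem_chart m) n4.
  have n6 := smooth_near_near sPhi.
  near=> u.
  have [cu uE] : cdomn m (ci m u) /\ cm m (ci m u) = u by near: u.
  split; first by [].
  - by split; near: u.
  - by near: u.
  - have h : forall v0, v0 \in DS D (ci m u) <-> exists c,
       v0 *m mjac (cm m) (ci m u) *m jac (@coord_incl _ _ _ i m) (cm m (ci m u)) =
       c *m X (cm m (ci m u)) by near: u.
    by move=> w wD; have [+ _] := h w; rewrite uE; exact.
  - by near: u.
have goodPsi : \forall y \near cm m m, good (Psi y).
  have := near_continuous (smooth_near_continuous sPsi) (U := good).
  by rewrite Psi0; apply.
pose y t := cm m m + t *: v.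
pose g t := ci m (Psi (y t)).
have [e e0 curve] : exists2 e : R, 0 < e & forall t, - e < t < e ->
    [/\ Phi (Psi (y t)) = y t, p (Psi (y t)) = p (cm m m) & good (Psi (y t))].
  have /near_normP[r r0 hr] := nearI PhiK (nearI pPsi goodPsi).
  exists (r / `|v|); first by rewrite divr_gt0// normr_gt0.
  move=> t te; have /hr[h1 [h2 h3]] : `|cm m m - y t| < r.
    rewrite /y opprD addNKr normrN normrZ -ltr_pdivlMr ?normr_gt0//.
    by rewrite ltr_norml.
  split=> //; rewrite h2 /y addrAC subrr add0r -scalemxAl.
  by rewrite [v *m _]vK scaler0 addr0.
have [L [iL Lm LP]] := leaf_proj_fibre DS_max m.
have [N [j [_ [sj j_ker] _ rj Tj]]] := iL.
have lift t : exists x, - e < t < e -> j x = g t.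
  have [te|nte] := boolP (- e < t < e); last first.
    by have : range j m by [rewrite rj]; case=> x _ _; exists x.
  have [_ pE [[gm gE] _ _ _ pig]] := curve t te.
  have : range j (g t).
    rewrite rj; apply/LP; symmetry.
    have e1 : ci (pi m) (cm (pi m) (pi (g t))) = pi (g t) by exact: cmapK.
    have e2 : ci (pi m) (cm (pi m) (pi m)) = pi m by exact: cmapK.
    apply: (etrans (esym e1)); apply: etrans e2.
    by congr (ci _ _); move: pE; rewrite /p /= cmapK.
  by case=> x _ xE; exists x.
have [x xP] := choice lift.
(* near x t0, the only point of N over the curve is x t0 *)
have isolated t0 : - e < t0 < e -> exists O : set N, [/\ open O, O (x t0) &
    forall t, - e < t < e -> O (x t) -> t = t0].
  move=> te0; have xj := xP t0 te0; set x0 := x t0 in xj *.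
  have [PhiPsi0 _ [[gm gE] [sPhi0 uPhi0] Bg Dg pig]] := curve t0 te0.
  set u0 := Psi (y t0) in PhiPsi0 gm gE sPhi0 uPhi0 Bg Dg pig *.
  have jx0 : j x0 = ci m u0 by [].
  have jm : cdomn m (j x0) by rewrite jx0.
  have jc : {for x0, continuous j} by exact: smooth_map_continuous.
  pose jh := cm m \o j \o ci x0.
  have sjh : smooth_near jh (cm x0 x0) by exact: smooth_map_msmooth.
  have jh0 : jh (cm x0 x0) = u0 by rewrite /jh /= cmapK// jx0.
  have sgm : smooth_near (Phi \o jh) (cm x0 x0) by apply: smooth_near_comp => //; rewrite jh0.
  set J := jac (Phi \o jh) (cm x0 x0).
  have JE : J = mjac (cm (j x0) \o j) x0 *m mjac (cm m) (j x0) *m jac Phi u0.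
    rewrite /J jac_comp ?jh0//; congr (_ *m _).
    by rewrite -mjac_smooth_map//; exact: msmooth_cmap.
  have J_free : row_free J.
    rewrite JE /row_free mxrankMfree ?row_free_unit// mxrankMfree.
      rewrite -[_ == _]/(row_free _) -kermx_eq0; apply/rowV0P => w /sub_kermxP wK.
      by apply/eqP; rewrite -memv0 -(j_ker x0) memv_ker tangent_mapE// wK.
    have [C [CK _]] := mjac_cmapK jm.
    by apply/row_freeP; exists C.
  have vJ w : v <> w *m J.
    rewrite JE => vE.
    have : tangent_map j x0 w \in DS D (j x0) by rewrite -Tj memv_img// memvf.
    have Dg' s : s = ci m u0 -> forall w, w \in DS D s -> exists c,
        w *m mjac (cm m) s *m jac (@coord_incl _ _ _ i m) u0 = c *m X u0.
      by move=> ->.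
    move=> /(Dg' _ jx0) [c cE].
    apply: (@row_free_col_mx_notin _ _ _ _ _ c Bg); rewrite -cE tangent_mapE//.
    by rewrite vE !mulmxA mulmxK.
  have := row_free_col_mx_rV J_free vJ => /mulmxVp.
  set Lam0 := pinvmx _ => LamE.
  pose Lam := rsubmx Lam0.
  have [vLam JLam] : v *m Lam = 0 /\ J *m Lam = 1%:M.
    move: LamE; rewrite -[Lam0]hsubmxK mul_col_row scalar_mx_block.
    by move=> /eq_block_mx[].
  have [sTh jTh] := smooth_near_mulmxr Lam sgm.
  rewrite JLam in jTh.
  have [Psi' [_ _ PsiK' _]] := local_inverse sTh jTh.
  have := chart_near_pull (mem_chart x0) PsiK' => inv_near.
  exists [set z | cdomn x0 z /\ Psi' ((Phi \o jh) (cm x0 z) *m Lam) = cm x0 z]°.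
  split; [exact: open_interior|exact: inv_near|].
  move=> t te /nbhs_singleton[x0x].
  have gE' t1 : - e < t1 < e -> cdomn x0 (x t1) -> (Phi \o jh) (cm x0 (x t1)) = y t1.
    move=> te1 x1; have [PhiPsi1 _ [[gm1 gE1] _ _ _ _]] := curve t1 te1.
    by rewrite /jh /= cmapK// xP// /g gE1.
  have yLam t1 : y t1 *m Lam = cm m m *m Lam.
    by rewrite /y mulmxDl -scalemxAl vLam scaler0 addr0.
  rewrite gE'// yLam => xE.
  have [_] := nbhs_singleton inv_near; rewrite gE'// yLam xE => xE'.
  have xx : x t = x0 by rewrite -[LHS](cmapK x0x) xE' cmapK.
  have := gE' t te x0x; rewrite xx gE'// => /addrI /eqP.
  by rewrite -subr_eq0 -scalerBl scaler_eq0 (negbTE v0) orbF subr_eq0 => /eqP.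
(* a basic open set that contains x t and no other point over the curve
   determines t *)
have [Bs cB [oB bB]] := manifold_second_countable (mstruct N).
have pick t : exists b : set N, - e < t < e -> [/\ Bs b, b (x t) &
    forall t', - e < t' < e -> b (x t') -> t' = t].
  have [te|nte] := boolP (- e < t < e); last by exists setT.
  have [W0 [W0_open W0x W0P]] := isolated t te.
  have [b [Bb bx] bO] := bB (x t) W0 (open_near W0_open W0x).
  by exists b => _; split=> // t' te' /bO; exact: W0P.
have [b bP] := choice pick.
apply: (@interval_uncountable R e e0); apply/countable_injP.
have /countable_injP[c c_inj] := cB.
exists (c \o b) => t t' /set_mem /= te /set_mem /= te' /= cE.
have [Bt bt tP] := bP t te; have [Bt' bt' t'P] := bP t' te'.
have bE : b t = b t' by apply: c_inj => //; exact/mem_set.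
by apply: t'P => //; rewrite -bE.
Unshelve. all: by end_near. Qed.
End Kernel.

(** * Brackets of invariant extensions *)
Lemma locally_constant_connected (T : topologicalType) (X : Type) (h : T -> X) :
  connected [set: T] -> (forall x, \forall y \near x, h y = h x) ->
  forall x y, h x = h y.
Proof.
move=> cT loc x0 y; suff all : [set y | h y = h x0] = setT.
  by have : [set y | h y = h x0] y by rewrite all.
apply: cT; first by exists x0.
  exists [set y | h y = h x0]; last by rewrite setTI.
  by rewrite openE => z /= zE; apply: filterS (loc z) => z' z'E; rewrite /= z'E.
exists [set y | h y = h x0]; last by rewrite setTI.
rewrite -[X in closed X]setCK; apply: open_closedC; rewrite openE => z /= zE.
by apply: filterS (loc z) => z' z'E; rewrite /= z'E.
Qed.

Section PairingAlgebra.
Context {R : realType}.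

Lemma pairingBl n (a b : 'cV[R]_n) v : pairing (a - b) v = pairing a v - pairing b v.
Proof. by rewrite /pairing mulmxBr [LHS]mxE [X in _ + X]mxE. Qed.

Lemma pairingDr n (a : 'cV[R]_n) v w : pairing a (v + w) = pairing a v + pairing a w.
Proof. by rewrite /pairing mulmxDl mxE. Qed.

Lemma tensor_evalBl (P : manifold R) (B : forall x : P, 'M[R]_(mdim x)) x
    (a a' b : cotangent R x) :
  tensor_eval B (a - a') b = tensor_eval B a b - tensor_eval B a' b.
Proof. by rewrite !sharpRE pairingBl. Qed.

Lemma tensor_evalBr (P : manifold R) (B : forall x : P, 'M[R]_(mdim x)) x
    (a b b' : cotangent R x) :
  tensor_eval B a (b - b') = tensor_eval B a b - tensor_eval B a b'.
Proof. by rewrite !sharpLE pairingBl opprB addrC opprK. Qed.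

Lemma tensor_eval_linl (P : manifold R) (B : forall x : P, 'M[R]_(mdim x)) x k l
    (a a' b : cotangent R x) :
  tensor_eval B (k *: a + l *: a') b = k * tensor_eval B a b + l * tensor_eval B a' b.
Proof.
rewrite !sharpRE /pairing mulmxDr -!scalemxAr mxE.
by congr (_ + _); rewrite mxE.
Qed.

Lemma tensor_eval_linr (P : manifold R) (B : forall x : P, 'M[R]_(mdim x)) x k l
    (a b b' : cotangent R x) :
  tensor_eval B a (k *: b + l *: b') = k * tensor_eval B a b + l * tensor_eval B a b'.
Proof.
rewrite !sharpLE /pairing mulmxDr -!scalemxAr mxE opprD !mulrN.
by congr (- _ - _); rewrite mxE.
Qed.

Lemma vspace_separation n (U : {vspace 'rV[R]_n}) w :
  (forall c, (forall v, v \in U -> pairing c v = 0) -> pairing c w = 0) -> w \in U.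
Proof.
move=> h; pose pr := (\1 - projv U)%VF.
suff : pr w = 0.
  by rewrite add_lfunE opp_lfunE id_lfunE => /eqP; rewrite subr_eq0 => /eqP ->; exact: memv_proj.
apply/rowP => j; rewrite [RHS]mxE.
have E v : pairing (col j (lin1_mx pr)) v = pr v 0 j.
  by rewrite /pairing colE mulmxA mul_rV_lin1 -colE mxE.
rewrite -E; apply: h => v vU; rewrite E add_lfunE opp_lfunE id_lfunE projv_id//.
by rewrite subrr mxE.
Qed.

End PairingAlgebra.

Section DfunRules.
Context {R : realType} {P : manifold R}.
Implicit Types (F G : P -> R) (x : P).

Lemma msmooth_lin (a : R) F G x : msmooth F x -> msmooth G x ->
  msmooth (a *: F + G) x /\ dfun (a *: F + G) x = a *: dfun F x + dfun G x.
Proof.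
move=> sF sG; pose F' := F \o ci x; pose G' := G \o ci x.
have saF : smooth_near (cst a * F') (cm x x).
  exact: (smooth_nearM (smooth_near_cst (a : R) _) sF).
have E : (a *: F + G) \o ci x = (cst a * F') + G' by [].
split; first by rewrite /msmooth E; exact: smooth_nearD.
rewrite -[LHS]/(grad ((a *: F + G) \o ci x) (cm x x)) E gradD// gradM//; last first.
  exact: smooth_near_cst.
by rewrite grad_cst scaler0 addr0.
Qed.

Lemma msmooth_mul F G x : msmooth F x -> msmooth G x ->
  msmooth (F * G) x /\ dfun (F * G) x = F x *: dfun G x + G x *: dfun F x.
Proof.
move=> sF sG; pose F' := F \o ci x; pose G' := G \o ci x.
have E : (F * G) \o ci x = F' * G' by [].
split; first by rewrite /msmooth E; exact: smooth_nearM.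
rewrite -[LHS]/(grad ((F * G) \o ci x) (cm x x)) E gradM//.
by rewrite /F' /G' /= cmapK.
Qed.

Lemma pairing_tangent_map (M : manifold R) (f : M -> P) (g : P -> R) (x : M) w :
  smooth_map f -> msmooth g (f x) ->
  pairing (dfun g (f x)) (tangent_map f x w) = pairing (dfun (g \o f) x) w.
Proof.
by move=> sf sg; rewrite (dfun_smooth_map sf sg) /pairing tangent_mapE// mulmxA.
Qed.

Lemma smooth_on_sub (U W : set P) F :
  open U -> open W -> W `<=` U -> smooth_on U F -> smooth_on W F.
Proof.
move=> oU oW sub sF; apply/(smooth_onP (@comp_stable_scalar R)) => // x /sub Ux.
by move: sF => /(smooth_onP (@comp_stable_scalar R) _ oU); exact.
Qed.

Lemma dfun_cst (c : R) x : dfun (cst c : P -> R) x = 0.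
Proof. exact: (grad_cst c (cm x x)). Qed.

End DfunRules.

Section LeafSpace.
Context {R : realType} {P S : manifold R} (i : S -> P).
Hypothesis i_emb : embedding i.
Variable D : forall s : S, {vspace tangent R (i s)}.
Hypothesis D_sub : subbundle_along D.
Hypothesis DS_smooth : smooth_distribution (DS D).
Hypothesis DS_max :
  forall s : S, exists2 L, maximal_integral_manifold (DS D) L & L s.
Variable A : smooth_structure R (leaf_space (DS D)).
Let Q : manifold R := Manifold A.
Let pi : S -> Q := leaf_proj (DS D).
Hypothesis pi_sub : submersion pi.

Let pi_smooth : smooth_map pi. Proof. by case: pi_sub. Qed.
Let i_smooth : smooth_map i. Proof. by case: i_emb => -[]. Qed.

Lemma pi_preimage_open (V : set Q) : open V -> open (pi @^-1` V).
Proof. by case: pi_smooth => /continuousP + _; apply. Qed.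

Lemma local_extension_msmooth (V : set Q) (f : Q -> R) m U F :
  open V -> V (pi m) -> local_extension (D := D) V f m U F -> msmooth (f \o pi) m.
Proof.
move=> oV Vm [oU Um sF FE].
have sFm : msmooth F (i m) by move: sF => /(smooth_onP (@comp_stable_scalar R) _ oU); exact.
apply: (@msmooth_near_eq _ _ _ (F \o i)); last exact: smooth_map_comp_msmooth.
have nV : \forall s \near m, V (pi s).
  exact: (open_near (pi_preimage_open oV) Vm).
have nU : \forall s \near m, U (i s).
  by apply: (near_continuous (smooth_map_continuous i_smooth)); exact: open_near.
by apply: filterS2 nV nU => s Vs Us /=; rewrite -FE.
Qed.

(** A section of the presheaf has a smooth lift near some point of each fibre
    only; it descends to a smooth function on the leaf space, whose lift is
    smooth at every point. *)
Lemma Cinf_leaf_msmooth (V : set Q) (f : Q -> R) m :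
  open V -> Cinf_leaf (D := D) V f -> V (pi m) -> msmooth f (pi m).
Proof.
move=> oV fV Vm; have [m' [U [F [pim FE]]]] := fV (pi m) Vm.
rewrite -pim; apply: (submersion_descends pi_sub) => //.
by apply: local_extension_msmooth FE => //; rewrite -[leaf_proj _ _]/(pi m') in pim *; rewrite pim.
Qed.

Lemma dfun_pi_DS (f : Q -> R) s v : msmooth f (pi s) -> v \in DS D s ->
  pairing (dfun (f \o pi) s) v = 0.
Proof.
move=> sf vD; rewrite dfun_smooth_map// /pairing mulmxA.
by rewrite (DS_sub_kernel DS_max pi_sub vD) mul0mx mxE.
Qed.

(** An invariant extension over a domain whose trace on S lies over V: its
    differential kills D at all points of the trace, as the definition of a
    canonical subbundle requires. *)
Definition good_extension (V : set Q) (f : Q -> R) m U F :=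
  invariant_extension (D := D) V f m U F /\ forall s, U (i s) -> V (pi s).

Lemma good_extension_exists (V : set Q) (f : Q -> R) m (a : cotangent R (i m)) :
  open V -> (forall z, V z -> msmooth f z) -> V (pi m) ->
  exists U F, good_extension V f m U F /\ (annihilates D a ->
    (forall v, pairing a (tangent_map i m v) = pairing (dfun (f \o pi) m) v) ->
    dfun F (i m) = a).
Proof.
move=> oV sf Vm.
have nV : nbhs m (pi @^-1` V) by exact: (open_near (pi_preimage_open oV) Vm).
have sfm : msmooth (f \o pi) m by apply: smooth_map_comp_msmooth => //; exact: sf.
have df0 : \forall s \near m, forall v, v \in DS D s -> pairing (dfun (f \o pi) s) v = 0.
  by apply: filterS nV => s Vs v; apply: dfun_pi_DS; exact: sf.
have [U [F [oU Um sF FE aE]]] := adapted_extension i_emb D_sub DS_smooth a nV sfm df0.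
exists U, F; split=> //; split; last by move=> s /FE[].
split; last by move=> s _ /FE[].
by split=> // s _ /FE[_ ->].
Qed.

Lemma good_extension_Cinf (V : set Q) (f : Q -> R) m :
  open V -> Cinf_leaf (D := D) V f -> V (pi m) -> exists U F, good_extension V f m U F.
Proof.
move=> oV fV Vm; have [|U [F [gF _]]] := @good_extension_exists V f m 0 oV _ Vm.
  move=> z Vz; have [m' [_ [_ [pim _]]]] := fV z Vz.
  by rewrite -pim; apply: Cinf_leaf_msmooth fV _ => //; rewrite /pi pim.
by exists U, F.
Qed.

Lemma extension_property : local_extension_property D.
Proof. by move=> V f oV fV m Vm; have [U [F []]] := good_extension_Cinf oV fV Vm; exists U, F. Qed.

Lemma msmooth_Cinf_leaf (V : set Q) (f : Q -> R) :
  open V -> (forall z, V z -> msmooth f z) -> Cinf_leaf (D := D) V f.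
Proof.
move=> oV sf z Vz; have zE : pi (repr z) = z by exact: reprK.
have [|U [F [[[eF _] _] _]]] := @good_extension_exists V f (repr z) 0 oV sf.
  by rewrite zE.
by exists (repr z), U, F.
Qed.

End LeafSpace.

Section Bracket.
Context {R : realType} {P S : manifold R} (i : S -> P).
Hypothesis i_emb : embedding i.
Variable D : forall s : S, {vspace tangent R (i s)}.
Hypothesis D_sub : subbundle_along D.
Hypothesis DS_smooth : smooth_distribution (DS D).
Hypothesis DS_max :
  forall s : S, exists2 L, maximal_integral_manifold (DS D) L & L s.
Variable A : smooth_structure R (leaf_space (DS D)).
Let Q : manifold R := Manifold A.
Let pi : S -> Q := leaf_proj (DS D).
Hypothesis pi_sub : submersion pi.
Variable B : forall x : P, 'M[R]_(mdim x).
Hypothesis B_smooth : forall U f g, open U -> smooth_on U f -> smooth_on U g ->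
  smooth_on U (tensor_bracket B f g).

Let pi_smooth : smooth_map pi. Proof. by case: pi_sub. Qed.
Let i_smooth : smooth_map i. Proof. by case: i_emb => -[]. Qed.

Lemma extension_msmooth (V : set Q) (f : Q -> R) m U F s :
  invariant_extension (D := D) V f m U F -> U (i s) -> msmooth F (i s).
Proof.
move=> [[oU _ sF _] _] Us.
by move: sF => /(smooth_onP (@comp_stable_scalar R) _ oU); exact.
Qed.

Lemma invariant_extension_move (V : set Q) (f : Q -> R) m m' U F :
  invariant_extension (D := D) V f m U F -> U (i m') ->
  invariant_extension (D := D) V f m' U F.
Proof. by move=> [[oU _ sF FE] aF] Um'; split. Qed.

(** Both extensions restrict to the same function on S, and both differentials
    kill D. *)
Lemma extension_diff_kills (V : set Q) (f : Q -> R) m U F U' F' :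
  open V -> V (pi m) ->
  invariant_extension (D := D) V f m U F -> invariant_extension (D := D) V f m U' F' ->
  forall v, v \in (TS i m + D m)%VS -> pairing (dfun F (i m) - dfun F' (i m)) v = 0.
Proof.
move=> oV Vm eF eF' v.
have [[oU Um sF FE] aF] := eF; have [[oU' Um' sF' FE'] aF'] := eF'.
have sFm := extension_msmooth eF Um; have sFm' := extension_msmooth eF' Um'.
move=> /memv_addP[_ /memv_imgP[w _ ->] [d dD ->]].
rewrite pairingDr [X in _ + X]pairingBl aF// aF'// subrr addr0 pairingBl.
apply/eqP; rewrite subr_eq0 !(@pairing_tangent_map _ _ _ _ _ _ _ i_smooth)//; apply/eqP.
congr (pairing _ w).
apply: grad_near_eq; apply: (chart_near_inv (mem_chart m) (U := fun s => F (i s) = F' (i s))).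
have nV : \forall s \near m, V (pi s).
  exact: (open_near (pi_preimage_open pi_sub oV) Vm).
have nU W : open W -> W (i m) -> \forall s \near m, W (i s).
  move=> oW Wm; apply: (near_continuous (smooth_map_continuous i_smooth)).
  exact: open_near.
by apply: filterS2 nV (nearI (nU U oU Um) (nU U' oU' Um')) => s Vs [Us Us']; rewrite -FE// FE'.
Qed.

Section Inclusion.
Hypothesis sharp_incl : forall (s : S) (a b : cotangent R (i s)),
  annihilates D a -> annihilates D b -> sharpL B a + sharpR B b \in (TS i s + D s)%VS.

Let annihilates0 s : annihilates D (0 : cotangent R (i s)).
Proof. by move=> v _; rewrite /pairing mulmx0 mxE. Qed.

Lemma sharpL_incl s (a : cotangent R (i s)) :
  annihilates D a -> sharpL B a \in (TS i s + D s)%VS.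
Proof.
by move=> aa; have := sharp_incl aa (@annihilates0 s); rewrite /sharpR mulmx0 trmx0 addr0.
Qed.

Lemma sharpR_incl s (b : cotangent R (i s)) :
  annihilates D b -> sharpR B b \in (TS i s + D s)%VS.
Proof.
by move=> aa; have := sharp_incl (@annihilates0 s) aa; rewrite /sharpL trmx0 mul0mx oppr0 add0r.
Qed.

Lemma bracket_indep (V : set Q) (f g : Q -> R) m U F U' F' W G W' G' :
  open V -> V (pi m) ->
  invariant_extension (D := D) V f m U F -> invariant_extension (D := D) V f m U' F' ->
  invariant_extension (D := D) V g m W G -> invariant_extension (D := D) V g m W' G' ->
  tensor_bracket B F G (i m) = tensor_bracket B F' G' (i m).
Proof.
move=> oV Vm eF eF' eG eG'; rewrite /tensor_bracket.
have aG : annihilates D (dfun G (i m)) by case: eG => -[_ Wm _ _]; apply.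
have aF' : annihilates D (dfun F' (i m)) by case: eF' => -[_ Wm _ _]; apply.
have h1 := extension_diff_kills oV Vm eF eF' (sharpR_incl aG).
have h2 := extension_diff_kills oV Vm eG eG' (sharpL_incl aF').
move: h1; rewrite -sharpRE tensor_evalBl => /eqP; rewrite subr_eq0 => /eqP ->.
move/eqP: h2; rewrite -oppr_eq0 -sharpLE tensor_evalBr subr_eq0 => /eqP -> //.
Qed.

Hypothesis D_canonical : canonical_along D B.

(** Invariant extensions are chosen at all points, and h s is the bracket of
    those chosen at s. Near s the extensions chosen at s serve at all points, so
    h is locally the restriction of the smooth function [F,G], whose
    differential kills D by canonicity; pulled back to the integral manifold
    through m it has zero gradient. *)
Lemma bracket_leaf (V : set Q) (f g : Q -> R) m m' U F U' F' W G W' G' :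
  open V -> V (pi m) -> Cinf_leaf (D := D) V f -> Cinf_leaf (D := D) V g -> pi m = pi m' ->
  invariant_extension (D := D) V f m U F -> invariant_extension (D := D) V f m' U' F' ->
  invariant_extension (D := D) V g m W G -> invariant_extension (D := D) V g m' W' G' ->
  tensor_bracket B F G (i m) = tensor_bracket B F' G' (i m').
Proof.
move=> oV Vm fV gV pimm' eF eF' eG eG'.
have ext (h : Q -> R) : Cinf_leaf (D := D) V h -> exists UF : S -> set P * (P -> R),
    forall s, V (pi s) -> good_extension (A := A) V h s (UF s).1 (UF s).2.
  move=> hV; have pt s : exists UF : set P * (P -> R),
      V (pi s) -> good_extension (A := A) V h s UF.1 UF.2.
    have [Vs|nVs] := pselect (V (pi s)); last by exists (setT, cst 0).
    have [U0 [F0 gF0]] := good_extension_Cinf i_emb D_sub DS_smooth DS_max pi_sub oV hV Vs.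
    by exists (U0, F0).
  by have [UF UFP] := choice pt; exists UF.
have [XF XFP] := ext f fV; have [XG XGP] := ext g gV.
pose K s := tensor_bracket B (XF s).2 (XG s).2.
pose h s := K s (i s).
have Vm' : V (pi m') by rewrite -pimm'.
rewrite (bracket_indep oV Vm eF (XFP m Vm).1 eG (XGP m Vm).1).
rewrite (bracket_indep oV Vm' eF' (XFP m' Vm').1 eG' (XGP m' Vm').1).
rewrite -[LHS]/(h m) -[RHS]/(h m').
have [L [iL Lm LP]] := leaf_proj_fibre DS_max m.
have [N [j [cN [sj _] _ rj Tj]]] := iL.
have VN x : V (pi (j x)).
  have : L (j x) by rewrite -rj; exists x.
  by move=> /LP mj; rewrite /pi -mj.
have loc x : \forall y \near x, h (j y) = h (j x).
  have [[[oU Um sF FE] aF] UV] := XFP _ (VN x).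
  have [[[oW Wm sG GE] aG] _] := XGP _ (VN x).
  set UF := (XF (j x)).1 in oU Um sF FE aF UV *; set UG := (XG (j x)).1 in oW Wm sG GE aG *.
  have oU0 : open (UF `&` UG) by exact: openI.
  have sK : smooth_on (UF `&` UG) (K (j x)).
    by apply: B_smooth => //; [apply: smooth_on_sub sF|apply: smooth_on_sub sG] => // z [].
  have aK : forall s, (UF `&` UG) (i s) -> annihilates D (dfun (K (j x)) (i s)).
    apply: D_canonical => //.
    - by apply: smooth_on_sub sF => // z [].
    - by apply: smooth_on_sub sG => // z [].
    - by move=> s [Us Ws]; split; [apply: aF|apply: aG] => //; exact: UV.
  have ij_near : \forall y \near x, (UF `&` UG) (i (j y)).
    apply: (near_continuous (f := j) (U := fun s => (UF `&` UG) (i s))).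
      exact: smooth_map_continuous.
    apply: (near_continuous (f := i)); first exact: smooth_map_continuous.
    exact: open_near.
  have hK : \forall y \near x, h (j y) = K (j x) (i (j y)).
    apply: filterS ij_near => y [Uy Wy]; have [eF0 _] := XFP _ (VN y); have [eG0 _] := XGP _ (VN y).
    have eF1 := invariant_extension_move (XFP _ (VN x)).1 Uy.
    have eG1 := invariant_extension_move (XGP _ (VN x)).1 Wy.
    exact: bracket_indep oV (VN y) eF0 eF1 eG0 eG1.
  have sKz z : (UF `&` UG) z -> msmooth (K (j x)) z.
    by move: sK => /(smooth_onP (@comp_stable_scalar R) _ oU0); exact.
  have grad0 : \forall u \near cm x x, smooth_near (K (j x) \o i \o j \o ci x) u /\
      grad (K (j x) \o i \o j \o ci x) u = 0.
    have dom : \forall y \near x, cdomn x y.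
      exact: (open_near (@cdom_open _ _ (mchart x))).
    have := chart_near_inv (mem_chart x) (nearI dom ij_near).
    apply: filterS2 (chart_near (mem_chart x)) => u [_ uE] [xu Uu].
    have sKi : msmooth (K (j x) \o i) (j (ci x u)).
      by apply: smooth_map_comp_msmooth => //; exact: sKz.
    have sKij : msmooth (K (j x) \o i \o j) (ci x u).
      by apply: (smooth_map_comp_msmooth (f := j)).
    split.
      rewrite -uE.
      by apply: (smooth_chart_change (@comp_stable_scalar R) (mem_chart (ci x u))).
    have d0 : dfun (K (j x) \o i \o j) (ci x u) = 0.
      apply/row_matrixP => l; rewrite row0 rowE; apply/matrixP => c d; rewrite !ord1 [RHS]mxE.
      rewrite -[LHS]/(pairing (dfun (K (j x) \o i \o j) (ci x u)) (delta_mx 0 l)).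
      rewrite -(@pairing_tangent_map _ _ _ _ _ _ _ sj sKi).
      rewrite -(@pairing_tangent_map _ _ _ _ _ _ _ i_smooth); last exact: sKz.
      have : tangent_map j (ci x u) (delta_mx 0 l) \in DS D (j (ci x u)).
        by rewrite -Tj memv_img// memvf.
      by rewrite mem_DS => /(aK (j (ci x u)) Uu).
    have [C [_ CK]] := mjac_cmapK xu.
    have := dfun_chart xu sKij; rewrite d0 uE => /(congr1 (mulmx C)).
    by rewrite mulmx0 mulmxA CK mul1mx => <-.
  have : \forall u \near cm x x,
      (K (j x) \o i \o j \o ci x) u = (K (j x) \o i \o j \o ci x) (cm x x).
    apply: zero_derive_locally_constant; apply: filterS grad0 => u [su gu] l.
    split; first exact: smooth_near_derivable.
    by move/colP: gu => /(_ l); rewrite !mxE.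
  move=> /(chart_near_pull (mem_chart x)); apply: filterS2 hK => y -> [xy].
  by rewrite /= !cmapK// => ->.
have [x0 _ x0E] : range j m by rewrite rj.
have [x1 _ x1E] : range j m' by rewrite rj; apply/LP.
rewrite -x0E -x1E; exact: (locally_constant_connected (h := h \o j) cN loc).
Qed.

Definition leaf_bracket (V : set Q) (f g : Q -> R) (z : Q) : R :=
  xget 0 [set r | exists m U F W G, [/\ pi m = z,
    invariant_extension (D := D) V f m U F, invariant_extension (D := D) V g m W G &
    r = tensor_bracket B F G (i m)]].

Lemma leaf_bracketE (V : set Q) (f g : Q -> R) m U F W G :
  open V -> V (pi m) -> Cinf_leaf (D := D) V f -> Cinf_leaf (D := D) V g ->
  invariant_extension (D := D) V f m U F -> invariant_extension (D := D) V g m W G ->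
  leaf_bracket V f g (pi m) = tensor_bracket B F G (i m).
Proof.
move=> oV Vm fV gV eF eG; rewrite /leaf_bracket; case: xgetP => [r _|].
  move=> [m' [U' [F' [W' [G' [pim' eF' eG' ->]]]]]].
  by apply: (bracket_leaf oV _ fV gV pim' eF' eF eG' eG); rewrite pim'.
by move=> /(_ (tensor_bracket B F G (i m))); case; exists m, U, F, W, G.
Qed.

End Inclusion.

Lemma invariant_extension_lin (V : set Q) (a : R) (f g : Q -> R) m U F W G :
  invariant_extension (D := D) V f m U F -> invariant_extension (D := D) V g m W G ->
  invariant_extension (D := D) V (a *: f + g) m (U `&` W) (a *: F + G).
Proof.
move=> eF eG; have [[oU Um sF FE] aF] := eF; have [[oW Wm sG GE] aG] := eG.
have sFP := (smooth_onP (@comp_stable_scalar R) F oU).1 sF.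
have sGP := (smooth_onP (@comp_stable_scalar R) G oW).1 sG.
split; [split|].
- exact: openI.
- by [].
- apply/(smooth_onP (@comp_stable_scalar R)); first exact: openI.
  by move=> x [Ux Wx]; have [] := msmooth_lin a (sFP x Ux) (sGP x Wx).
- by move=> s Vs [Us Ws]; rewrite -[RHS]/(a * F (i s) + G (i s)) -FE// -GE.
- move=> s Vs [Us Ws] v vD; have [_ ->] := msmooth_lin a (sFP _ Us) (sGP _ Ws).
  rewrite /pairing mulmxDr -scalemxAr mxE [X in X + _]mxE.
  rewrite -[X in _ * X]/(pairing _ v) (aF s)//.
  by rewrite -[X in _ + X]/(pairing _ v) (aG s)// mulr0 addr0.
Qed.

Lemma invariant_extension_mul (V : set Q) (f g : Q -> R) m U F W G :
  invariant_extension (D := D) V f m U F -> invariant_extension (D := D) V g m W G ->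
  invariant_extension (D := D) V (f * g) m (U `&` W) (F * G).
Proof.
move=> eF eG; have [[oU Um sF FE] aF] := eF; have [[oW Wm sG GE] aG] := eG.
have sFP := (smooth_onP (@comp_stable_scalar R) F oU).1 sF.
have sGP := (smooth_onP (@comp_stable_scalar R) G oW).1 sG.
split; [split|].
- exact: openI.
- by [].
- apply/(smooth_onP (@comp_stable_scalar R)); first exact: openI.
  by move=> x [Ux Wx]; have [] := msmooth_mul (sFP x Ux) (sGP x Wx).
- by move=> s Vs [Us Ws]; rewrite -[RHS]/(F (i s) * G (i s)) -FE// -GE.
- move=> s Vs [Us Ws] v vD; have [_ ->] := msmooth_mul (sFP _ Us) (sGP _ Ws).
  rewrite /pairing mulmxDr -!scalemxAr mxE [X in X + _]mxE [X in _ + X]mxE.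
  rewrite -[X in _ * X + _]/(pairing _ v) (aG s)//.
  by rewrite -[X in _ + _ * X]/(pairing _ v) (aF s)// !mulr0 addr0.
Qed.

Let invariant_at (V : set Q) (f : Q -> R) z : open V -> Cinf_leaf (D := D) V f -> V z ->
  exists U F, invariant_extension (D := D) V f (repr z) U F.
Proof.
move=> oV fV Vz; apply: (extension_property i_emb D_sub DS_smooth DS_max pi_sub oV fV).
by rewrite -[leaf_proj _ _]/(pi _) [pi _]reprK.
Qed.

Let pi_repr (z : Q) : pi (repr z) = z. Proof. exact: reprK. Qed.

Lemma Cinf_leaf_lin (V : set Q) (a : R) (f g : Q -> R) : open V ->
  Cinf_leaf (D := D) V f -> Cinf_leaf (D := D) V g -> Cinf_leaf (D := D) V (a *: f + g).
Proof.
move=> oV fV gV z Vz; have [U [F eF]] := invariant_at oV fV Vz.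
have [W [G eG]] := invariant_at oV gV Vz.
exists (repr z), (U `&` W), (a *: F + G); split; first exact: pi_repr.
by have [] := invariant_extension_lin a eF eG.
Qed.

Lemma Cinf_leaf_mul (V : set Q) (f g : Q -> R) : open V ->
  Cinf_leaf (D := D) V f -> Cinf_leaf (D := D) V g -> Cinf_leaf (D := D) V (f * g).
Proof.
move=> oV fV gV z Vz; have [U [F eF]] := invariant_at oV fV Vz.
have [W [G eG]] := invariant_at oV gV Vz.
exists (repr z), (U `&` W), (F * G); split; first exact: pi_repr.
by have [] := invariant_extension_mul eF eG.
Qed.

Lemma tensor_bracket_lin (a : R) (F G H : P -> R) x :
  msmooth F x -> msmooth G x ->
  tensor_bracket B (a *: F + G) H x = a * tensor_bracket B F H x + tensor_bracket B G H x /\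
  tensor_bracket B H (a *: F + G) x = a * tensor_bracket B H F x + tensor_bracket B H G x.
Proof.
move=> sF sG; rewrite /tensor_bracket; have [_ ->] := msmooth_lin a sF sG.
rewrite -[X in _ *: _ + X]scale1r -[X in _ * _ + X]mul1r.
rewrite -[in X in _ /\ X](mul1r (tensor_eval _ _ (dfun G x))).
by rewrite tensor_eval_linl tensor_eval_linr.
Qed.

Lemma tensor_bracket_mul (F G H : P -> R) x :
  msmooth F x -> msmooth G x ->
  tensor_bracket B (F * G) H x =
    tensor_bracket B F H x * G x + F x * tensor_bracket B G H x /\
  tensor_bracket B H (F * G) x =
    F x * tensor_bracket B H G x + G x * tensor_bracket B H F x.
Proof.
move=> sF sG; rewrite /tensor_bracket; have [_ ->] := msmooth_mul sF sG.
rewrite tensor_eval_linl tensor_eval_linr.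
by split; [rewrite addrC; congr (_ + _); exact: mulrC|].
Qed.

(** * Reducibility and the inclusion *)

Lemma inclusion_reducible : canonical_along D B ->
  (forall (s : S) (a b : cotangent R (i s)),
     annihilates D a -> annihilates D b ->
     sharpL B a + sharpR B b \in (TS i s + D s)%VS) ->
  leibniz_reducible D B.
Proof.
move=> canD incl; split; first exact: (extension_property i_emb D_sub DS_smooth DS_max pi_sub).
exists leaf_bracket; split; last first.
  by move=> V f g oV fV gV m U F W G Vm eF eG; exact: (leaf_bracketE incl canD oV Vm fV gV eF eG).
move=> V oV; have brE := leaf_bracketE incl canD oV.
split=> [f g fV gV z Vz|a f g h fV gV hV].
  have [U [F eF]] := invariant_at oV fV Vz; have [W [G eG]] := invariant_at oV gV Vz.
  exists (repr z), (U `&` W), (tensor_bracket B F G); split; first exact: pi_repr.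
  have [[oU Um sF FE] aF] := eF; have [[oW Wm sG GE] aG] := eG.
  have oUW : open (U `&` W) by exact: openI.
  split=> //.
    apply: B_smooth => //.
      by apply: smooth_on_sub sF => // x [].
    by apply: smooth_on_sub sG => // x [].
  move=> s Vs [Us Ws].
  exact: (brE _ _ _ _ _ _ _ Vs fV gV (invariant_extension_move eF Us)
    (invariant_extension_move eG Ws)).
have sE (k : Q -> R) m U K : invariant_extension (D := D) V k m U K -> msmooth K (i m).
  by move=> eK; apply: (extension_msmooth eK); case: eK => -[].
have valE (k : Q -> R) m U K : V (pi m) -> invariant_extension (D := D) V k m U K ->
    k (pi m) = K (i m).
  by move=> Vm [[_ Um _ KE] _]; exact: KE.
split=> z /set_mem Vz;
  have [U [F eF]] := invariant_at oV fV Vz;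
  have [W [G eG]] := invariant_at oV gV Vz;
  have [X [H eH]] := invariant_at oV hV Vz;
  have Vm : V (pi (repr z)) by rewrite pi_repr.
- rewrite -[z]pi_repr.
  rewrite -[RHS]/(a * leaf_bracket V f h (pi (repr z)) + leaf_bracket V g h (pi (repr z))).
  rewrite (brE _ _ _ _ _ _ _ Vm (Cinf_leaf_lin a oV fV gV) hV
    (invariant_extension_lin a eF eG) eH).
  rewrite (brE _ _ _ _ _ _ _ Vm fV hV eF eH) (brE _ _ _ _ _ _ _ Vm gV hV eG eH).
  by have [-> _] := tensor_bracket_lin a H (sE _ _ _ _ eF) (sE _ _ _ _ eG).
- rewrite -[z]pi_repr.
  rewrite -[RHS]/(a * leaf_bracket V h f (pi (repr z)) + leaf_bracket V h g (pi (repr z))).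
  rewrite (brE _ _ _ _ _ _ _ Vm hV (Cinf_leaf_lin a oV fV gV) eH
    (invariant_extension_lin a eF eG)).
  rewrite (brE _ _ _ _ _ _ _ Vm hV fV eH eF) (brE _ _ _ _ _ _ _ Vm hV gV eH eG).
  by have [_ ->] := tensor_bracket_lin a H (sE _ _ _ _ eF) (sE _ _ _ _ eG).
- rewrite -[z]pi_repr.
  rewrite -[RHS]/(leaf_bracket V f h (pi (repr z)) * g (pi (repr z)) +
                  f (pi (repr z)) * leaf_bracket V g h (pi (repr z))).
  rewrite (brE _ _ _ _ _ _ _ Vm (Cinf_leaf_mul oV fV gV) hV (invariant_extension_mul eF eG) eH).
  rewrite (brE _ _ _ _ _ _ _ Vm fV hV eF eH) (brE _ _ _ _ _ _ _ Vm gV hV eG eH).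
  rewrite (valE _ _ _ _ Vm eF) (valE _ _ _ _ Vm eG).
  by have [-> _] := tensor_bracket_mul H (sE _ _ _ _ eF) (sE _ _ _ _ eG).
- rewrite -[z]pi_repr.
  rewrite -[RHS]/(g (pi (repr z)) * leaf_bracket V f h (pi (repr z)) +
                  h (pi (repr z)) * leaf_bracket V f g (pi (repr z))).
  rewrite (brE _ _ _ _ _ _ _ Vm fV (Cinf_leaf_mul oV gV hV) eF (invariant_extension_mul eG eH)).
  rewrite (brE _ _ _ _ _ _ _ Vm fV hV eF eH) (brE _ _ _ _ _ _ _ Vm fV gV eF eG).
  rewrite (valE _ _ _ _ Vm eG) (valE _ _ _ _ Vm eH).
  by have [_ ->] := tensor_bracket_mul F (sE _ _ _ _ eG) (sE _ _ _ _ eH).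
Qed.

(** The restriction of a to TS kills D_S = ker T pi, so it factors through
    T pi. *)
Lemma kernel_covector m (a : cotangent R (i m)) : annihilates D a ->
  exists lam : cotangent R (pi m), forall v,
    pairing a (tangent_map i m v) = (v *m (mjac (cm (pi m) \o pi) m *m lam)) 0 0.
Proof.
move=> aD; set J := mjac _ m; pose b := mjac (cm (i m) \o i) m *m a.
have [T TJ] := submersion_right_inverse pi_sub m.
exists (T *m b) => v; rewrite /pairing tangent_mapE// -mulmxA -/b.
suff -> : J *m (T *m b) = b by [].
apply/eqP; rewrite eq_sym -subr_eq0 mulmxA -[X in X - _]mul1mx -mulmxBl.
apply/eqP/row_matrixP => l; rewrite row_mul row0.
have : row l (1%:M - J *m T) \in DS D m.
  apply: (kernel_sub_DS i_emb D_sub DS_max pi_sub).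
  by rewrite -row_mul mulmxBl mul1mx -mulmxA TJ mulmx1 subrr row0.
rewrite mem_DS => /aD; rewrite /pairing tangent_mapE// -mulmxA -/b => h.
by apply/matrixP => x y; rewrite !ord1 h mxE.
Qed.

(** Here f is linear in the chart at pi s, with differential the covector from
    which a restricted to TS comes. The zero function has the invariant
    extensions G with dG = c at s, and 0. *)
Lemma reducible_orthogonal s (a c : cotangent R (i s)) :
  leibniz_reducible D B -> annihilates D a ->
  (forall v, v \in (TS i s + D s)%VS -> pairing c v = 0) ->
  tensor_eval B a c = 0 /\ tensor_eval B c a = 0.
Proof.
move=> [_ [brQ [_ brE]]] aD cK.
pose V : set Q := cdomn (pi s).
have oV : open V by exact: cdom_open.
have Vs : V (pi s) by exact: mem_chart.
have [lam lamE] := kernel_covector aD.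
pose phi (w : 'rV[R]_(mdim (pi s))) : R := (w *m lam) 0 0.
have sphi w : smooth_near phi w.
  have [sid _] := smooth_near_id w; have [h _] := smooth_near_mulmxr lam sid.
  by move/smooth_near_mxP: h; apply.
pose f : Q -> R := phi \o cm (pi s).
have sf z : V z -> msmooth f z.
  move=> Vz; apply: (msmooth_postcomp (@comp_stable_scalar R)) => //.
  exact: msmooth_cmap.
have s0 z : V z -> msmooth (cst 0 : Q -> R) z by move=> _; exact: msmooth_cst.
have fV : Cinf_leaf (D := D) V f.
  exact: (msmooth_Cinf_leaf i_emb D_sub DS_smooth DS_max pi_sub oV sf).
have zV : Cinf_leaf (D := D) V (cst 0).
  exact: (msmooth_Cinf_leaf i_emb D_sub DS_smooth DS_max pi_sub oV s0).
have gphi : grad phi (cm (pi s) (pi s)) = lam.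
  apply/colP => j; rewrite mxE.
  have -> : phi = (fun x : 'rV[R]_1 => x 0 0) \o mulmxr lam by [].
  have [sl jl] := linear_smooth
    (mulmxr lam : {linear 'rV[R]_(mdim (pi s)) -> 'rV[R]_1}) (cm (pi s) (pi s)).
  have := congr1 (fun M : 'M_(_, 1) => M j 0) jl; rewrite mxE => E.
  rewrite -[LHS]/('D_(delta_mx 0 j) (fun v => mulmxr lam v 0 0) (cm (pi s) (pi s))).
  by rewrite E mxE /= -rowE mxE.
have [U [F [[eF _] dF]]] := good_extension_exists i_emb D_sub DS_smooth DS_max pi_sub a oV sf Vs.
have {}dF : dfun F (i s) = a.
  apply: dF => // v; rewrite lamE (dfun_smooth_map pi_smooth (sf _ Vs)) /pairing.
  congr ((_ *m (_ *m _)) 0 0).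
  rewrite -gphi; apply: grad_near_eq; apply: filterS (chart_near (mem_chart (pi s))) => u [_ uE].
  by rewrite /f /= uE.
have cD : annihilates D c by move=> v vD; apply: cK; exact: (subvP (addvSr _ _)).
have [W [G [[eG _] dG]]] := good_extension_exists i_emb D_sub DS_smooth DS_max pi_sub c oV s0 Vs.
have {}dG : dfun G (i s) = c.
  apply: dG => // v; rewrite cK; last first.
    by apply: (subvP (addvSl _ _)); apply: memv_img; exact: memvf.
  by rewrite [dfun _ _](dfun_cst (0 : R)) /pairing mulmx0 mxE.
have e0 : invariant_extension (D := D) V (cst 0) s setT (cst 0 : P -> R).
  split; [split=> //|].
  - exact: openT.
  - by apply/(smooth_onP (@comp_stable_scalar R)); [exact: openT|move=> x _; exact: msmooth_cst].
  - by move=> t _ _ v _; rewrite dfun_cst /pairing mulmx0 mxE.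
have te0 : tensor_eval B a (0 : cotangent R (i s)) = 0 by rewrite /tensor_eval mulmx0 mxE.
have t0e : tensor_eval B (0 : cotangent R (i s)) a = 0 by rewrite /tensor_eval trmx0 !mul0mx mxE.
have h1 := brE V f (cst 0) oV fV zV s _ _ _ _ Vs eF eG.
have h2 := brE V f (cst 0) oV fV zV s _ _ _ _ Vs eF e0.
have h3 := brE V (cst 0) f oV zV fV s _ _ _ _ Vs eG eF.
have h4 := brE V (cst 0) f oV zV fV s _ _ _ _ Vs e0 eF.
rewrite h1 in h2; rewrite h3 in h4.
move: h2 h4; rewrite /tensor_bracket dF dG dfun_cst te0 t0e.
by split.
Qed.

Lemma reducible_inclusion : leibniz_reducible D B ->
  forall (s : S) (a b : cotangent R (i s)), annihilates D a -> annihilates D b ->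
  sharpL B a + sharpR B b \in (TS i s + D s)%VS.
Proof.
move=> red s a b aD bD; apply: memvD; apply: vspace_separation => c cK.
  have [h _] := reducible_orthogonal red aD cK.
  by apply/eqP; rewrite -oppr_eq0 -sharpLE h.
have [_ h] := reducible_orthogonal red bD cK.
by rewrite -sharpRE.
Qed.

End Bracket.

Theorem theorem6p15 (R : realType) (P : manifold R)
    (br : (P -> R) -> (P -> R) -> (P -> R))
    (B : forall x : P, 'M[R]_(mdim x))
    (br_leibniz : leibniz_bracket br)
    (br_tensor : leibniz_tensor br B)
    (S : manifold R) (i : S -> P) (i_emb : embedding i)
    (D : forall s : S, {vspace tangent R (i s)})
    (D_subbundle : subbundle_along D)
    (D_canonical : canonical_along D B)
    (DS_smooth : smooth_distribution (DS D))
    (DS_integrable : integrable (DS D))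
    (DS_regular : regular_distribution (DS D)) :
  leibniz_reducible D B <->
  (forall (s : S) (a b : cotangent R (i s)),
     annihilates D a -> annihilates D b ->
     (sharpL B a + sharpR B b)%R \in (TS i s + D s)%VS).
Proof.
case: DS_regular => DS_max [A [_ pi_sub]]; case: br_tensor => B_smooth _.
split=> [red s a b|incl].
  exact: (reducible_inclusion i_emb D_subbundle DS_smooth DS_max pi_sub red).
exact: (inclusion_reducible i_emb D_subbundle DS_smooth DS_max pi_sub).
Qed.
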